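(* For every word $x \in A^{\#}$ there exists a unique prime factorization of $x$, i.e. there is exactly one densely non-increasing sequence $(u_\beta)_{\beta<\alpha}$ (for some countable ordinal $\alpha$) of prime words such that $x = \prod_{\beta<\alpha} u_\beta$.
   Context: $A$ is a finite alphabet with a linear order $<_A$. A word is a sequence $x=(a_\beta)_{\beta<\alpha}$ of letters indexed by a countable ordinal $\alpha=|x|$; $A^{\#}$ is the set of all such words. Concatenation $xy$ has length $|x|+|y|$; for a sequence $(x_\beta)_{\beta<\alpha}$ of words, $\prod_{\beta<\alpha}x_\beta$ is their concatenation in order, and $x^\alpha=\prod_{\beta<\alpha}x$. For $0\le\gamma\le|x|$, $x[0,\gamma)$ is a prefix and $x[\gamma,|x|)$ a suffix of $x$; it is proper when $0<\gamma<|x|$. Write $x \le_{pre} x'$ if $x$ is a prefix of $x'$. Write $x <_{str} x'$ if there are letters $a<_A b$ and words $y,z,z'$ with $x=yaz$, $x'=ybz'$. The lexicographic order is $x\le_{lex}x'$ iff $x\le_{pre}x'$ or $x<_{str}x'$ (with strict version $<_{lex}$). A word $x$ is primitive if $x=y^\alpha$ implies $\alpha=1$ and $y=x$. A word $w$ is prime (Lyndon) if it is primitive and every proper suffix $z$ of $w$ satisfies $w\le_{lex} z$. For a linear order $(U,<)$, a sequence $(u_\beta)_{\beta<\alpha}$ in $U$ is constant on $[\gamma,\gamma')$ if $u_\beta=u_\gamma$ for all $\gamma\le\beta<\gamma'$; it is densely non-increasing if for all $\gamma<\gamma'\le\alpha$, either it is constant on $[\gamma,\gamma')$ or there exist $\gamma\le\beta<\beta'<\gamma'$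 with $u_\beta>u_{\beta'}$. Sequences of words are ordered by $<_{lex}$. *)

(* Defs.v *)
(* Transfinite words over a finite
   linearly ordered alphabet.  Countable ordinals are represented by countable
   well-ordered types; ordinal equality is order isomorphism, word equality is
   label-preserving order isomorphism. *)
From mathcomp Require Import all_boot all_order.
Unset Printing Implicit Defensive.
Import Order.TTheory.
Local Open Scope order_scope.

Record cwo := CWO {
  pos :> Type;
  plt : pos -> pos -> Prop;
  plt_irrefl : forall x, ~ plt x x;
  plt_trans : forall x y z, plt x y -> plt y z -> plt x z;
  plt_total : forall x y, x = y \/ plt x y \/ plt y x;
  plt_wf : well_founded plt;
  pos_countable : exists f : pos -> nat, injective f }.

Arguments plt {c} x y.
Definition ple {a : cwo} (x y : a) := x = y \/ plt x y.

Definition ord_iso {a b : cwo} (f : a -> b) :=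
  bijective f /\ forall x y, plt x y <-> plt (f x) (f y).

Definition is_one (a : cwo) := exists e : a, forall x : a, x = e.

Record word (A : Type) := Word { wlen : cwo; wlab : wlen -> A }.
Arguments Word {A} wlen wlab.
Arguments wlab {A} w p.
Arguments wlen {A} w.

Section Words.
Context {A : Type}.

Definition word_eq (x y : word A) :=
  exists f : wlen x -> wlen y, ord_iso f /\ forall p, wlab y (f p) = wlab x p.

Definition realizes (x : word A) {T : Type} (lt : T -> T -> Prop) (lab : T -> A) :=
  exists f : wlen x -> T, bijective f /\
    (forall p q, plt p q <-> lt (f p) (f q)) /\ forall p, wlab x p = lab (f p).

Definition sig_lt {J : cwo} (u : J -> word A) (s t : {j : J & wlen (u j)}) :=
  plt (projT1 s) (projT1 t) \/
  exists (j : J) (p q : wlen (u j)),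
    s = existT _ j p /\ t = existT _ j q /\ plt p q.
Definition sig_lab {J : cwo} (u : J -> word A) (s : {j : J & wlen (u j)}) :=
  wlab (u (projT1 s)) (projT2 s).
Definition is_prod {J : cwo} (u : J -> word A) (x : word A) :=
  realizes x (sig_lt u) (sig_lab u).

Definition sum_lt {a b : cwo} (s t : a + b) :=
  match s, t with
  | inl p, inl q => plt p q
  | inr p, inr q => plt p q
  | inl _, inr _ => True
  | inr _, inl _ => False
  end.
Definition is_cat (x y z : word A) :=
  realizes x (@sum_lt (wlen y) (wlen z))
    (fun s => match s with inl p => wlab y p | inr q => wlab z q end).

Definition restr (x : word A) (S : wlen x -> Prop) (y : word A) :=
  realizes y (fun s t : {p | S p} => plt (sval s) (sval t))
    (fun s => wlab x (sval s)).

Definition is_prefix (y x : word A) :=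
  (exists p : wlen x, restr x (fun q => plt q p) y) \/ restr x (fun _ => True) y.

Definition proper_suffix (z x : word A) :=
  exists p : wlen x, (exists q, plt q p) /\ restr x (fun q => ~ plt q p) z.

Definition primitive (x : word A) :=
  forall (y : word A) (a : cwo), is_prod (fun _ : a => y) x ->
    is_one a /\ word_eq y x.
End Words.

Definition unit_cwo : cwo.
Proof.
refine (@CWO unit (fun _ _ => False) _ _ _ _ _).
- by move=> ? [].
- by move=> ? ? ? [].
- by case; case; left.
- by move=> x; constructor.
- by exists (fun _ => 0%N); case; case.
Defined.
Definition letter {A : Type} (a : A) : word A := Word unit_cwo (fun _ => a).

Section Lex.
Context {d : Order.disp_t} {A : orderType d}.

Definition str_lt (x x' : word A) :=
  exists (a b : A) (y z z' w w' : word A),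
    a < b /\ is_cat w y (letter a) /\ is_cat x w z /\
    is_cat w' y (letter b) /\ is_cat x' w' z'.

Definition lex_le (x x' : word A) := is_prefix x x' \/ str_lt x x'.
Definition lex_lt (x x' : word A) := lex_le x x' /\ ~ word_eq x x'.

Definition prime_word (w : word A) :=
  primitive w /\ forall z, proper_suffix z w -> lex_le w z.

(* beta < g' where g' : option J, None standing for the length alpha *)
Definition below {J : cwo} (b : J) (g' : option J) :=
  match g' with None => True | Some c => plt b c end.
Definition in_iv {J : cwo} (g : J) (g' : option J) (b : J) :=
  ple g b /\ below b g'.

Definition densely_nonincreasing {J : cwo} (u : J -> word A) :=
  forall (g : J) (g' : option J), below g g' ->
    (forall b, in_iv g g' b -> word_eq (u b) (u g)) \/
    exists b b', in_iv g g' b /\ in_iv g g' b' /\ plt b b' /\ lex_lt (u b') (u b).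

Definition prime_factorization (x : word A) {J : cwo} (u : J -> word A) :=
  (forall j, prime_word (u j)) /\ densely_nonincreasing u /\ is_prod u x.
End Lex.

(* Main.v *)
(** A word is encoded as a function from ordinals to [option A], with [None] past
    its length and [None] least, so that the lexicographic order, prefixes
    included, is comparison at the first difference.  The key fact is that a prime
    word [v] larger than a nonempty word [w] is larger than the infinite power of
    [w]: at the first place where [v] would fall below it, the suffix of [v]
    starting at the current copy of [w] contradicts minimality, or [v] is itself a
    proper power.

    Existence: overlapping prime factors of [x] have a prime union, and so do
    increasing unions of prime factors with a common start, so the maximal prime
    factors tile [x].  If an interval of tiles had no descent without being
    constant, it would start with a run of copies of some [u] followed by a tile
    [v > u]; the product of these is again prime, against maximality.

    Uniqueness: no prime factor strictly extends a tile [u] of a densely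
    non-increasing tiling.  Otherwise the extension contains a tile smaller than
    [u], and a shortest such tile [w] starts a suffix of the extension that is at
    most the infinite power of [w], hence smaller than [u]. *)
From HB Require Import structures.
Require Import Defs.
From mathcomp Require Import all_boot all_order.
From mathcomp Require Import boolp.
Set Implicit Arguments.
Unset Strict Implicit.
Import Order.TTheory.
Local Open Scope order_scope.

(** * Well-founded trees as ordinal notations *)

(* Ordinals are well-founded trees up to mutual [tle]; the tree [ONode f] stands
   for the least ordinal above all the [f i]. *)
Inductive otree := ONode (T : Type) (f : T -> otree).

Fixpoint tle (a b : otree) : Prop :=
  match a, b with ONode T f, ONode U g => forall i, exists j, tle (f i) (g j) end.

Definition tlt (a b : otree) : Prop :=
  match b with ONode U g => exists j, tle a (g j) end.

Lemma tle_node T (f : T -> otree) b : tle (ONode f) b <-> forall i, tlt (f i) b.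
Proof. by case: b. Qed.

Lemma tle_refl a : tle a a.
Proof. by elim: a => T f IH /= i; exists i; apply: IH. Qed.

Lemma tle_trans a b c : tle a b -> tle b c -> tle a c.
Proof.
elim: a b c => T f IH [U g] [V h] /= ab bc i.
have [j /IH fg] := ab i; have [k gh] := bc j.
by exists k; apply: fg.
Qed.

Lemma tlt_le_trans a b c : tlt a b -> tle b c -> tlt a c.
Proof.
case: b c => U g [V h] /= [j ab] bc; have [k gh] := bc j.
by exists k; apply: tle_trans ab gh.
Qed.

Lemma tle_lt_trans a b c : tle a b -> tlt b c -> tlt a c.
Proof. by case: c => V h ab /= [k bc]; exists k; apply: tle_trans ab bc. Qed.

Lemma tltW a b : tlt a b -> tle a b.
Proof.
elim: a b => T f IH [U g] [j /tle_node fg]; apply/tle_node => i.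
by exists j; apply: IH.
Qed.

(** The two alternatives are proved together: the first for [a] rests on the second for the children
    of [a], and the second for [a] on the first. *)
Lemma tle_total a b : (tle a b \/ tlt b a) /\ (tlt a b \/ tle b a).
Proof.
elim: a b => T f IH b.
have le_or : forall c, tle (ONode f) c \/ tlt c (ONode f).
  move=> c; have [lec|/existsNP[i Ni]] := EM (forall i, tlt (f i) c).
    by left; apply/tle_node.
  by right; exists i; case: (IH i c) => _ [].
split=> //; elim: b => U g IHb.
have [[j lej]|Nex] := EM (exists j, tle (ONode f) (g j)); first by left; exists j.
right; apply/tle_node => j; case: (le_or (g j)) => // lej.
by case: Nex; exists j.
Qed.

Lemma tlt_wf : well_founded tlt.
Proof.
have accP a : forall b, tle b a -> Acc tlt b.
  elim: a => T f IH b ba; constructor=> c cb.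
  by have [i ci] := tlt_le_trans cb ba; apply: IH ci.
by move=> a; apply: accP (tle_refl a).
Qed.

Lemma tlt_irrefl a : ~ tlt a a.
Proof. by elim: (tlt_wf a) => {}a _ IH aa; exact: (IH a aa aa). Qed.

Lemma tltP a b : tlt a b <-> ~ tle b a.
Proof.
split=> [ab ba|]; first exact: tlt_irrefl (tlt_le_trans ab ba).
by case: (tle_total a b) => _ [].
Qed.

Lemma tle_ext a b : (forall t, tlt t a -> tlt t b) -> tle a b.
Proof.
case: a => T f H; apply/tle_node => i; apply: H.
by exists i; apply: tle_refl.
Qed.

(** The children of [a] recur at every node, so that adding the empty tree gives [a] back up to
    mutual [tle]. *)
Fixpoint tadd (a b : otree) {struct b} : otree :=
  match b with ONode U g =>
    match a with ONode T f => ONode (fun s : T + U =>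
      match s with inl i => f i | inr j => tadd a (g j) end)
    end
  end.

(** Quantifying over all [c] below [b], and not only over the children of [b], makes the description
    depend on [b] only up to mutual [tle], so that it passes to ordinals. *)
Lemma tlt_add t a b : tlt t (tadd a b) <->
  tlt t a \/ exists c, tlt c b /\ tle t (tadd a c).
Proof.
have addP U (g : U -> otree) t' : tlt t' (tadd a (ONode g)) <->
    tlt t' a \/ exists j, tle t' (tadd a (g j)).
  case: a => T f; split.
    by move=> [[i|j] le]; [left; exists i|right; exists j].
  by move=> [[i le]|[j le]]; [exists (inl i)|exists (inr j)].
have mono b1 b2 : tle b1 b2 -> tle (tadd a b1) (tadd a b2).
  elim: b1 b2 => U g IH [V h] gh.
  apply: tle_ext => s /addP[sa|[j sj]]; apply/addP; first by left.
  by have [k jk] := gh j; right; exists k; apply: tle_trans sj (IH _ _ jk).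
case: b => U g; split=> [/addP[|[j le]]|[?|[c [[j cj] tc]]]].
- by left.
- by right; exists (g j); split=> //; exists j; apply: tle_refl.
- by apply/addP; left.
- by apply/addP; right; exists j; apply: tle_trans tc (mono _ _ cj).
Qed.

(** * Ordinals as classes of trees *)

Definition oclass (a : otree) : otree -> Prop := fun b => tle a b /\ tle b a.

(** Classes are predicates, so extensionality turns mutual [tle] into Leibniz equality of
    ordinals. *)
Definition Ord := {P : otree -> Prop | exists a, P = oclass a}.
Definition omk (a : otree) : Ord := exist _ (oclass a) (ex_intro _ a erefl).
Definition orepr (o : Ord) : otree := sval (cid (svalP o)).

Lemma oreprP o : sval o = oclass (orepr o).
Proof. by rewrite /orepr; case: cid. Qed.

Lemma omkK a : tle a (orepr (omk a)) /\ tle (orepr (omk a)) a.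
Proof.
have : oclass a a by split; apply: tle_refl.
by rewrite -[oclass a]/(sval (omk a)) oreprP => -[].
Qed.

Lemma oclass_inj a b : tle a b -> tle b a -> oclass a = oclass b.
Proof.
move=> ab ba; apply/funext => c; apply/propext.
by split=> -[ac ca]; split;
  [apply: tle_trans ba ac | apply: tle_trans ca ab
  |apply: tle_trans ab ac | apply: tle_trans ca ba].
Qed.

HB.instance Definition _ := gen_eqMixin Ord.
HB.instance Definition _ := gen_choiceMixin Ord.

Definition ole (x y : Ord) := `[< tle (orepr x) (orepr y) >].

Lemma ole_refl : reflexive ole.
Proof. by move=> x; apply/asboolP/tle_refl. Qed.

Lemma ole_anti : antisymmetric ole.
Proof.
move=> x y /andP[/asboolP xy /asboolP yx].
have : sval x = sval y by rewrite !oreprP (oclass_inj xy yx).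
by case: x y {xy yx} => P p [Q q] /= E; apply: eq_exist.
Qed.

Lemma ole_trans : transitive ole.
Proof.
by move=> y x z /asboolP xy /asboolP yz; apply/asboolP/(tle_trans xy yz).
Qed.

Fact ord_display : Order.disp_t. Proof. exact: Order.Disp tt tt. Qed.

HB.instance Definition _ :=
  Order.Le_isPOrder.Build ord_display Ord ole_refl ole_anti ole_trans.

Lemma ole_total : total (<=%O : rel Ord).
Proof.
move=> x y; apply/orP; case: (tle_total (orepr x) (orepr y)) => [[xy|/tltW yx] _].
  by left; apply/asboolP.
by right; apply/asboolP.
Qed.

HB.instance Definition _ :=
  Order.POrder_isTotal.Build ord_display Ord ole_total.

Section OrdinalOrder.
Implicit Types a b x y : Ord.

Lemma oleE x y : x <= y <-> tle (orepr x) (orepr y).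
Proof. by split=> [/asboolP|?]; last apply/asboolP. Qed.

Lemma oltE x y : x < y <-> tlt (orepr x) (orepr y).
Proof.
split=> [|/tltP yx]; first by rewrite ltNge => /negP yx; apply/tltP => /oleE.
by rewrite ltNge; apply/negP => /oleE.
Qed.

Lemma olt_wf : well_founded (fun x y : Ord => x < y).
Proof.
move=> x; have [t] : exists t, orepr x = t by exists (orepr x).
elim: (tlt_wf t) x => {}t _ IH x xt.
by constructor=> y /oltE yx; apply: (IH (orepr y)) erefl; rewrite -xt.
Qed.

Lemma omin (P : Ord -> Prop) :
  (exists a, P a) -> exists a, P a /\ forall b, P b -> a <= b.
Proof.
case=> a; elim: (olt_wf a) => {}a _ IH Pa.
have [[b [Pb ba]]|Nb] := EM (exists b, P b /\ b < a); first exact: IH ba Pb.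
by exists a; split=> // b Pb; rewrite leNgt; apply/negP => ba; case: Nb; exists b.
Qed.

(** The least ordinal strictly above all [f i], unlike the usual supremum given by [olub]. Zero,
    one, ranks and lengths are instances. *)
Definition osup T (f : T -> Ord) : Ord := omk (ONode (fun i => orepr (f i))).

Lemma lt_osup T (f : T -> Ord) x : x < osup f <-> exists i, x <= f i.
Proof.
have [le1 le2] := omkK (ONode (fun i => orepr (f i))).
split=> [/oltE/tlt_le_trans/(_ le2)[i /oleE]|[i /oleE xi]]; first by exists i.
by apply/oltE; apply: tlt_le_trans le1; exists i.
Qed.

End OrdinalOrder.

Definition oadd (x y : Ord) : Ord := omk (tadd (orepr x) (orepr y)).

Infix "+o" := oadd (at level 50, left associativity).

(** The laws of addition below rest on this description of the ordinals below a sum, with no further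
    recourse to trees. *)
Lemma lt_oadd (x a b : Ord) : x < a +o b <-> x < a \/ exists c, c < b /\ x <= a +o c.
Proof.
have ltE (t : otree) : tlt t (orepr (a +o b)) <-> tlt t (tadd (orepr a) (orepr b)).
  by have [l1 l2] := omkK (tadd (orepr a) (orepr b)); split=> /tlt_le_trans; apply.
have mono (c d : otree) : tle c d -> tle (tadd (orepr a) c) (tadd (orepr a) d).
  move=> cd; apply: tle_ext => t /tlt_add[l|[e [ec le]]]; apply/tlt_add.
    by left.
  by right; exists e; split=> //; apply: tlt_le_trans ec cd.
rewrite !oltE ltE tlt_add; split=> [[|[c [cb xc]]]|[|[c [cb xc]]]]; try by left.
  right; exists (omk c); have [l1 l2] := omkK c; split.
    by apply/oltE; apply: tle_lt_trans l2 cb.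
  apply/oleE; apply: tle_trans xc _.
  have [m1 m2] := omkK (tadd (orepr a) (orepr (omk c))).
  by apply: tle_trans m1; apply: mono.
right; exists (orepr c); split; first exact/oltE.
by move/oleE: xc => /tle_trans; apply; case: (omkK (tadd (orepr a) (orepr c))).
Qed.

(** * Ordinal arithmetic *)

Section OrdinalArithmetic.
Implicit Types a b c x y z : Ord.

Definition ozero : Ord := osup (fun e : False => match e with end).

Lemma le0o a : ozero <= a.
Proof. by rewrite leNgt; apply/negP => /lt_osup[[]]. Qed.

Lemma lto0 a : (a < ozero) = false.
Proof. by apply/negbTE; rewrite -leNgt le0o. Qed.

Lemma le_ext x y : (forall z, z < x -> z < y) -> x <= y.
Proof. by move=> H; rewrite leNgt; apply/negP => /H; rewrite ltxx. Qed.

Lemma oadd0 a : a +o ozero = a.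
Proof.
apply/le_anti/andP; split; apply: le_ext => z.
  by move=> /lt_oadd[//|[c []]]; rewrite lto0.
by move=> za; apply/lt_oadd; left.
Qed.

Lemma lt_add2l a : {mono oadd a : b c / b < c}.
Proof.
have H b c : b < c -> a +o b < a +o c.
  by move=> bc; apply/lt_oadd; right; exists b.
move=> b c; apply/idP/idP=> [|/H//].
by apply: contraTT; rewrite -!leNgt le_eqVlt => /predU1P[->|/H/ltW].
Qed.

Lemma le_add2l a : {mono oadd a : b c / b <= c}.
Proof. by move=> b c; rewrite !leNgt lt_add2l. Qed.

Lemma oaddI a : injective (oadd a).
Proof.
move=> b c E; apply/le_anti/andP.
by rewrite -(le_add2l a) -[c <= b](le_add2l a) E lexx.
Qed.

Lemma le_addr a b : a <= a +o b.
Proof. by rewrite -{1}(oadd0 a) le_add2l le0o. Qed.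

Lemma le_addl a b : b <= a +o b.
Proof.
elim: (olt_wf b) => {}b _ IH; apply: le_ext => z zb.
by apply: (le_lt_trans (IH z zb)); rewrite lt_add2l.
Qed.

Lemma oaddA a b c : a +o (b +o c) = a +o b +o c.
Proof.
elim: (olt_wf c) => {}c _ IH.
apply/le_anti/andP; split; apply: le_ext => z.
  move=> /lt_oadd[za|[d [/lt_oadd[db|[e [ec de]]] zd]]]; apply/lt_oadd.
  - by left; apply: lt_le_trans (le_addr _ _).
  - by left; apply: le_lt_trans zd _; rewrite lt_add2l.
  - right; exists e; rewrite -IH //; split=> //.
    by apply: le_trans zd _; rewrite le_add2l.
move=> /lt_oadd[/lt_oadd[za|[d [db zd]]]|[e [ec ze]]]; apply/lt_oadd.
- by left.
- by right; exists d; split=> //; apply: lt_le_trans (le_addr _ _).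
- by right; exists (b +o e); rewrite lt_add2l IH.
Qed.

Lemma add0o a : ozero +o a = a.
Proof.
elim: (olt_wf a) => {}a _ IH; apply/le_anti; rewrite le_addl andbT.
apply: le_ext => z /lt_oadd[|[c [ca zc]]]; first by rewrite lto0.
by rewrite (le_lt_trans zc) ?IH.
Qed.

Lemma lt_addr a b : (a < a +o b) = (ozero < b).
Proof. by rewrite -{1}(oadd0 a) lt_add2l. Qed.

Lemma ogt0 a b : a < b -> ozero < b.
Proof. by apply: le_lt_trans; apply: le0o. Qed.

(** Left subtraction: [c] is the least ordinal with [b <= a +o c], and a strict inequality would
    yield a smaller one by [lt_oadd]. *)
Lemma oadd_sub a b : a <= b -> exists c, b = a +o c.
Proof.
move=> ab; have [|c [bc cmin]] := @omin (fun c => b <= a +o c).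
  by exists b; apply: le_addl.
exists c; apply/le_anti; rewrite bc leNgt /=; apply/negP => /lt_oadd[|[d [dc bd]]].
  by rewrite ltNge ab.
by have := cmin d bd; rewrite leNgt dc.
Qed.

Lemma oadd_sub_lt a b : a < b -> exists c, ozero < c /\ b = a +o c.
Proof.
move=> ab; have [c E] := oadd_sub (ltW ab).
by exists c; rewrite -(lt_addr a) -E.
Qed.

Lemma le_add2r c a b : a <= b -> a +o c <= b +o c.
Proof. by move=> /oadd_sub[d ->]; rewrite -oaddA le_add2l le_addl. Qed.

Lemma ord0_or_pos a : a = ozero \/ ozero < a.
Proof. by case: (ltgtP ozero a) => [||->]; rewrite ?lto0; auto. Qed.

Lemma olub (P : Ord -> Prop) M : (forall a, P a -> a <= M) ->
  exists m, (forall a, P a -> a <= m) /\ forall b, b < m -> exists a, P a /\ b < a.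
Proof.
move=> PM; have [|m [ub mmin]] := @omin (fun b => forall a, P a -> a <= b).
  by exists M.
exists m; split=> // b bm; apply: contrapT => N.
have: m <= b.
  by apply: mmin => a Pa; rewrite leNgt; apply/negP => ba; apply: N; exists a.
by rewrite leNgt bm.
Qed.

End OrdinalArithmetic.

(** * Multiples of an ordinal and remainders *)

(** The ordinals [n] times some ordinal, obtained without defining multiplication by closing zero
    under adding [n] on the right and under limits. The recursive occurrence in [omult_lim] is
    nested in an existential, so proofs induct on the ordinal and then split the predicate. *)
Inductive omult (n : Ord) : Ord -> Prop :=
| omult0 : omult n ozero
| omultS g : omult n g -> omult n (g +o n)
| omult_lim g : (forall q, q < g -> exists r, q < r /\ r < g /\ omult n r) ->
    omult n g.

Lemma omult_step n g g' : ozero < n -> omult n g -> omult n g' ->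
  g < g' -> g +o n <= g'.
Proof.
move=> n0; elim: (olt_wf g') g => {}g' _ IH g Gg Gg'.
case: Gg' IH => [|h Gh|h limh] IH gg'.
- by rewrite lto0 in gg'.
- case: (ltgtP g h) => [gh|hg|->] //.
    apply: (@le_trans _ _ h); last exact: le_addr.
    by apply: (IH h) => //; rewrite lt_addr.
  by have := IH g gg' h Gh Gg hg; rewrite leNgt gg'.
- have [r [gr [rh Gr]]] := limh g gg'.
  exact: le_trans (IH r rh g Gg Gr gr) (ltW rh).
Qed.

(** The supremum of the multiples up to [i] is a multiple, either attained or by [omult_lim]. A
    remainder of at least [n] would leave room for one more copy. *)
Lemma omult_mod n i : ozero < n -> exists g r, omult n g /\ r < n /\ i = g +o r.
Proof.
move=> n0; have [] := @olub (fun g => omult n g /\ g <= i) i; first by move=> a [].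
move=> m [ub cof]; have Gm : omult n m.
  have [[b [bm [Gb bi]]]|N] := EM (exists b, b = m /\ omult n b /\ b <= i).
    by rewrite -bm.
  apply: omult_lim => q /cof[a [[Ga ai] qa]]; exists a; split=> //; split=> //.
  rewrite lt_neqAle ub // andbT; apply/eqP => am; apply: N; by exists a.
have mi : m <= i.
  apply: le_ext => z /cof[a [[_ ai] za]]; exact: lt_le_trans za ai.
have [r E] := oadd_sub mi; exists m, r; split=> //; split=> //.
rewrite ltNge; apply/negP => nr.
have: m +o n <= m by apply: ub; split; [exact: omultS | rewrite E le_add2l].
by rewrite leNgt lt_addr n0.
Qed.

Lemma omod_uniq n g r g' r' : omult n g -> omult n g' -> r < n -> r' < n ->
  g +o r = g' +o r' -> g = g' /\ r = r'.
Proof.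
move=> Gg Gg' rn rn'; wlog gg' : g g' r r' Gg Gg' rn rn' / g <= g'.
  move=> W E; case: (leP g g') => [gg'|/ltW gg']; first exact: W.
  by have [] := W _ _ _ _ Gg' Gg rn' rn gg' (esym E).
move: gg'; rewrite le_eqVlt => /predU1P[-> /oaddI //|gg' E].
have: g +o r < g' +o r'.
  apply: lt_le_trans (le_addr _ _).
  apply: lt_le_trans (omult_step (ogt0 rn) Gg Gg' gg').
  by rewrite lt_add2l.
by rewrite E ltxx.
Qed.

(** Positivity of [n] sits under the existential so that [omod] is total; for [n] zero its value is
    a default. *)
Lemma omod_ex n i : exists r,
  ozero < n -> exists g, omult n g /\ r < n /\ i = g +o r.
Proof.
have [n0|N] := EM (ozero < n); last by exists i => /N.
by have [g [r H]] := omult_mod i n0; exists r => _; exists g.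
Qed.

Definition omod (n i : Ord) : Ord := sval (cid (omod_ex n i)).

Lemma omodP n i : ozero < n -> exists g, omult n g /\ omod n i < n /\ i = g +o omod n i.
Proof. by move=> n0; apply: (svalP (cid (omod_ex n i))). Qed.

Lemma omodE n g r : omult n g -> r < n -> omod n (g +o r) = r.
Proof.
move=> Gg rn; have [g' [Gg' [rn' E]]] := omodP (g +o r) (ogt0 rn).
by have [_ /esym] := omod_uniq Gg Gg' rn rn' E.
Qed.

Lemma omod_small n r : r < n -> omod n r = r.
Proof. by move=> rn; rewrite -{1}[r]add0o; apply: omodE => //; apply: omult0. Qed.

Lemma le_omod n i : ozero < n -> omod n i <= i.
Proof. by move=> /(omodP i)[g [_ [_ {2}->]]]; apply: le_addl. Qed.

Lemma omult_ge n g : ozero < n -> omult n g -> ozero < g -> n <= g.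
Proof.
by move=> n0 Gg g0; rewrite -[n]add0o; apply: omult_step => //; apply: omult0.
Qed.

Lemma omult_add n g h : ozero < n -> omult n g -> omult n h -> omult n (g +o h).
Proof.
move=> n0 Gg Gh; elim: (olt_wf h) Gh => {}h _ IH Gh.
have [->|h0] := ord0_or_pos h; first by rewrite oadd0.
case: Gh h0 IH => [|k Gk|k lim] h0 IH; first by rewrite oadd0.
  by rewrite oaddA; apply: omultS; apply: IH Gk; rewrite lt_addr.
apply: omult_lim => q /lt_oadd[qg|[e [eh qe]]].
  by exists g; rewrite lt_addr.
have [r [er [rh Gr]]] := lim e eh; exists (g +o r).
by rewrite lt_add2l (le_lt_trans qe) ?lt_add2l //; do 2!split=> //; apply: IH.
Qed.

Lemma omod_addl n g i : ozero < n -> omult n g -> omod n (g +o i) = omod n i.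
Proof.
move=> n0 Gg; have [h [Gh [rn {1}->]]] := omodP i n0.
by rewrite oaddA omodE //; apply: omult_add.
Qed.

Definition oone : Ord := osup (fun _ : unit => ozero).

Lemma lt1o a : (a < oone) = (a == ozero).
Proof.
apply/idP/eqP => [/lt_osup[_ a0]|->]; last by apply/lt_osup; exists tt.
by apply/le_anti; rewrite a0 le0o.
Qed.

Lemma add1_le a b : a < b -> a +o oone <= b.
Proof.
move=> ab; apply: le_ext => z /lt_oadd[/lt_trans->//|[c []]].
by rewrite lt1o => /eqP->; rewrite oadd0 => /le_lt_trans->.
Qed.

(** * Streams and prime factors *)

Section Streams.
Context {d : Order.disp_t} {A : orderType d}.
Local Notation stream := (Ord -> option A).
Implicit Types f g h u v w : stream.

Definition opt_lt (u v : option A) : bool :=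
  match v, u with
  | None, _ => false
  | Some _, None => true
  | Some b, Some a => a < b
  end.

Lemma opt_lt_irrefl (u : option A) : opt_lt u u = false.
Proof. by case: u => //= a; rewrite ltxx. Qed.

Lemma opt_lt_trans (u v w : option A) : opt_lt u v -> opt_lt v w -> opt_lt u w.
Proof. by case: u v w => [a|] [b|] [c|] //=; apply: lt_trans. Qed.

Lemma opt_lt_total (u v : option A) : u = v \/ opt_lt u v \/ opt_lt v u.
Proof.
case: u v => [a|] [b|] /=; auto.
by case: (ltgtP a b) => [||->]; auto.
Qed.

Definition slt f g := exists i, (forall j, j < i -> f j = g j) /\ opt_lt (f i) (g i).
Definition sle f g := f = g \/ slt f g.

Lemma slt_total f g : f = g \/ slt f g \/ slt g f.
Proof.
have [E|N] := EM (forall i, f i = g i); first by left; apply/funext.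
have [|i [fi imin]] := @omin (fun i => f i <> g i); first exact/existsNP.
have eqlt j : j < i -> f j = g j.
  by move=> ji; apply: contrapT => /imin; rewrite leNgt ji.
case: (opt_lt_total (f i) (g i)) => [//|[fg|gf]]; right; [left|right]; exists i => //.
by split=> // j /eqlt.
Qed.

Lemma slt_irrefl f : ~ slt f f.
Proof. by case=> i [_]; rewrite opt_lt_irrefl. Qed.

Lemma slt_trans f g h : slt f g -> slt g h -> slt f h.
Proof.
move=> [i [Ei Li]] [j [Ej Lj]]; case: (ltgtP i j) => [ij|ji|eij].
- exists i; split=> [k ki|]; first by rewrite Ei // Ej // (lt_trans ki).
  by rewrite -Ej.
- exists j; split=> [k kj|]; first by rewrite Ei ?Ej // (lt_trans kj).
  by rewrite Ei.
- rewrite -eij in Ej Lj; exists i; split=> [k ki|]; first by rewrite Ei // Ej.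
  exact: opt_lt_trans Li Lj.
Qed.

Lemma sle_lt_trans f g h : sle f g -> slt g h -> slt f h.
Proof. by case=> [->//|]; apply: slt_trans. Qed.

Lemma slt_le_trans f g h : slt f g -> sle g h -> slt f h.
Proof. by move=> fg [<-//|]; apply: slt_trans. Qed.

Lemma sle_trans f g h : sle f g -> sle g h -> sle f h.
Proof. by case=> [->//|fg] gh; right; apply: slt_le_trans fg gh. Qed.

Lemma sltNle f g : slt f g <-> ~ sle g f.
Proof.
split=> [fg gf|]; first exact: slt_irrefl (slt_le_trans fg gf).
by case: (slt_total f g) => [->|[//|gf]] []; [left|right].
Qed.

Lemma sleNlt f g : sle f g <-> ~ slt g f.
Proof. by rewrite sltNle; split=> [?|/contrapT]. Qed.

Lemma sle_anti f g : sle f g -> sle g f -> f = g.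
Proof. by case=> // fg /(slt_le_trans fg)/slt_irrefl. Qed.

Definition shift (t : Ord) f : stream := fun i => f (t +o i).
Definition sub f (p q : Ord) : stream :=
  fun i => if p +o i < q then f (p +o i) else None.
Definition has_len f l := forall i, isSome (f i) = (i < l).

(** A power of a word of length [n] appears here as a stream whose length is a multiple of [n] and
    whose letters depend only on the position modulo [n]. *)
Definition primitive_stream f := forall n l,
  has_len f l -> ozero < n -> omult n l -> (forall i, i < l -> f i = f (omod n i)) ->
  n = l.
Definition min_stream f := forall t, isSome (f t) -> sle f (shift t f).
Definition prime_stream f :=
  isSome (f ozero) /\ primitive_stream f /\ min_stream f.

(* The infinite power of [w], meaningful only when [n] is the length of [w]. *)
Definition pinf (n : Ord) w : stream := fun i => w (omod n i).

Lemma has_len_None f l i : has_len f l -> l <= i -> f i = None.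
Proof. by move=> fl li; move: (fl i); case: (f i) => //= s; rewrite ltNge li. Qed.

Lemma has_len_uniq f l l' : has_len f l -> has_len f l' -> l = l'.
Proof.
by move=> fl fl'; apply/le_anti/andP; split; apply: le_ext => z; rewrite -fl -fl'.
Qed.

Lemma isSome_pinf n w i : ozero < n -> has_len w n -> isSome (pinf n w i).
Proof. by move=> n0 wn; rewrite wn; have [g [_ []]] := omodP i n0. Qed.

Lemma opt_ltN (u v : option A) : opt_lt u v -> opt_lt v u = false.
Proof.
by move=> uv; apply/negP => /(opt_lt_trans uv); rewrite opt_lt_irrefl.
Qed.

Lemma opt_lt_isSome (u v : option A) : opt_lt u v -> isSome v.
Proof. by case: v. Qed.

Lemma pinf_lt_prime v w n : prime_stream v -> (exists l, has_len v l) ->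
  has_len w n -> ozero < n -> slt w v -> slt (pinf n w) v.
Proof.
move=> [_ [vprim vmin]] [l vl] wn n0 wv.
case: (slt_total (pinf n w) v) => [E|[//|[i [Ei Li]]]].
  by have := isSome_pinf l n0 wn; rewrite E vl ltxx.
(* The difference is located at offset [r] in the copy of [w] that starts at [g]. *)
have [g [Gg [rn Er]]] := omodP i n0; set r := omod n i in rn Er.
have gi : g <= i by rewrite Er le_addr.
have pg j : pinf n w (g +o j) = pinf n w j by rewrite /pinf omod_addl.
have ps j : j < n -> pinf n w j = w j by move=> jn; rewrite /pinf omod_small.
have il : i <= l.
  rewrite leNgt; apply/negP => li; have := isSome_pinf l n0 wn.
  by rewrite -Ei // vl ltxx.
(* If that copy starts inside [v], the suffix of [v] at [g] is smaller than [w]. For [g] zero this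
   contradicts [w] below [v]; otherwise [v] begins with [w], and the suffix contradicts
   minimality. *)
case: (ltP g l) => [gl|lg].
  have shr : opt_lt (shift g v r) (w r) by rewrite -(ps r rn) -pg /shift -Er.
  have shE j : j < r -> shift g v j = w j.
    move=> jr; rewrite -(ps j (lt_trans jr rn)) -pg -Ei //.
    by rewrite Er lt_add2l.
  have [g0|g0] := ord0_or_pos g.
    have vs : shift g v = v by apply/funext => j; rewrite /shift g0 add0o.
    rewrite vs in shr shE; case: (@slt_irrefl w); apply: slt_trans wv _.
    by exists r.
  have ng := omult_ge n0 Gg g0.
  have vw j : j < n -> v j = w j.
    by move=> jn; rewrite -ps // Ei // (lt_le_trans jn) ?(le_trans ng).
  have /sleNlt[] : sle v (shift g v) by apply: vmin; rewrite vl.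
  exists r; rewrite vw //; split=> // j jr.
  by rewrite shE // vw // (lt_trans jr).
(* Here [v] ends exactly where a copy of [w] would start, so it is a power of [w]; primitivity
   leaves one copy, whence [v = w]. *)
have gE : g = l by apply/le_anti; rewrite lg (le_trans gi il).
have iE : i = l by apply/le_anti; rewrite il -gE gi.
have nl : n = l.
  rewrite -gE in vl Gg *; apply: (vprim n) => // j; rewrite gE -iE => ji.
  have mn : omod n j < n by have [k [_ []]] := omodP j n0.
  rewrite !Ei //; first by rewrite /pinf (omod_small mn).
  by apply: le_lt_trans ji; apply: le_omod.
case: (@slt_irrefl v); rewrite {1}(_ : v = w) //; apply/funext => j.
case: (ltP j n) => [jn|nj]; first by rewrite Ei ?ps // iE -nl.
by rewrite !(has_len_None _ nj) // nl.
Qed.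

(** * Prime factors of a fixed stream *)

Section Fixed.
Variables (X : stream) (L : Ord).
Hypothesis XL : has_len X L.
Local Notation fac := (sub X).

Lemma facE p q i : p +o i < q -> fac p q i = X (p +o i).
Proof. by rewrite /sub => ->. Qed.

Lemma isSome_fac p q i : q <= L -> isSome (fac p q i) = (p +o i < q).
Proof.
move=> qL; rewrite /sub; case: ifP => // pq.
by rewrite XL (lt_le_trans pq).
Qed.

Lemma fac_isSome p q i : isSome (fac p q i) -> p +o i < q.
Proof. by rewrite /sub; case: ifP. Qed.

Lemma fac_None p q i : q <= p +o i -> fac p q i = None.
Proof. by rewrite /sub ltNge => ->. Qed.

Lemma shift_fac t p q : shift t (fac p q) = fac (p +o t) q.
Proof. by apply/funext => i; rewrite /shift /sub oaddA. Qed.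

Lemma has_len_fac p l : p +o l <= L -> has_len (fac p (p +o l)) l.
Proof. by move=> pL i; rewrite isSome_fac // lt_add2l. Qed.

Lemma sle_fac_prefix p q q' : q <= q' -> sle (fac p q) (fac p q').
Proof.
move=> qq'; apply/sleNlt => -[i [_ Li]].
have piq := fac_isSome (opt_lt_isSome Li).
by move: Li; rewrite !facE ?opt_lt_irrefl // (lt_le_trans piq).
Qed.

(** A strict difference lies inside both factors, because [p <= t], and survives extension. If the
    factors are equal, they have a common length [l] with [p +o l = t +o l = q], which absorption
    allows for distinct [p] and [t]; the extensions then read the same letters from [q] on. *)
Lemma sle_fac_extend p t q q' : p <= t -> t < q -> q <= q' -> q' <= L ->
  sle (fac p q) (fac t q) -> sle (fac p q') (fac t q').
Proof.
move=> pt tq qq' q'L; have qL := le_trans qq' q'L.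
have [l ql] := oadd_sub (le_trans pt (ltW tq)).
have [k qk] := oadd_sub (ltW tq).
case=> [E|[r [Er Lr]]].
  have lk : l = k.
    have H1 : has_len (fac p q) l by rewrite ql; apply: has_len_fac; rewrite -ql.
    have H2 : has_len (fac t q) k by rewrite qk; apply: has_len_fac; rewrite -qk.
    by rewrite E in H1; apply: has_len_uniq H1 H2.
  left; apply/funext => i; case: (ltP i l) => [il|/oadd_sub[j ->]].
    have e1 : p +o i < q by rewrite ql lt_add2l.
    have e2 : t +o i < q by rewrite qk lt_add2l -lk.
    rewrite !facE ?(lt_le_trans _ qq') //.
    by have := congr1 (fun f => f i) E; rewrite !facE.
  by rewrite /sub !oaddA -ql lk -qk.
have trq := fac_isSome (opt_lt_isSome Lr).
have H j : j <= r -> [/\ fac p q j = fac p q' j & fac t q j = fac t q' j].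
  move=> jr; have tj : t +o j < q by apply: le_lt_trans trq; rewrite le_add2l.
  have pj : p +o j < q by apply: le_lt_trans tj; apply: le_add2r.
  by rewrite !facE // (lt_le_trans _ qq').
right; exists r; split=> [j jr|]; last by have [<- <-] := H r (lexx r).
by have [<- <-] := H j (ltW jr); apply: Er.
Qed.

Definition prime_fac p q := [/\ q <= L, p < q & prime_stream (fac p q)].

Lemma prime_fac_min p q t : prime_fac p q -> p <= t -> t < q ->
  sle (fac p q) (fac t q).
Proof.
move=> [qL pq [_ [_ fmin]]] /oadd_sub[k ->] tq.
by rewrite -shift_fac; apply: fmin; rewrite isSome_fac.
Qed.

Lemma prime_facI p q : q <= L -> p < q -> primitive_stream (fac p q) ->
  (forall t, p <= t -> t < q -> sle (fac p q) (fac t q)) -> prime_fac p q.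
Proof.
move=> qL pq pr mn; split=> //; split; first by rewrite isSome_fac // oadd0.
split=> // t /fac_isSome ptq; rewrite shift_fac; apply: mn => //.
exact: le_addr.
Qed.

Lemma has_len_facE p q l : q <= L -> p < q -> has_len (fac p q) l -> q = p +o l.
Proof.
move=> qL /ltW/oadd_sub[k E] H; rewrite E; congr (_ +o _).
by apply: has_len_uniq H; rewrite E; apply: has_len_fac; rewrite -E.
Qed.

(* A proper power that is minimal equals suffixes of itself that start
   arbitrarily late, in particular one inside the prime suffix. *)
Lemma prime_of_suffix p s q : p <= s -> prime_fac s q ->
  (forall t, p <= t -> t < q -> sle (fac p q) (fac t q)) -> prime_fac p q.
Proof.
move=> ps Psq mn; have [qL sq [_ [zprim _]]] := Psq.
have pq := le_lt_trans ps sq; apply: prime_facI => // n l fl n0 Gl per.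
have El := has_len_facE qL pq fl.
apply: contrapT => nl; case: Gl (Gl) El nl fl per => [|g Gg|g lim] Gl El nl fl per.
- by move: pq; rewrite El oadd0 ltxx.
- have [g0|g0] := ord0_or_pos g; first by case: nl; rewrite g0 add0o.
  have ng := omult_ge n0 Gg g0.
  (* The last of at least two copies is a suffix that is also a proper prefix of the whole, hence
     smaller. *)
  have /sleNlt[] : sle (fac p q) (fac (p +o g) q).
    by apply: mn; rewrite ?le_addr // El lt_add2l lt_addr.
  exists n; rewrite -shift_fac; split=> [j jn|].
    rewrite /shift per ?lt_add2l // omod_addl // omod_small //.
  rewrite /shift [fac p q (g +o n)]fac_None ?El ?le_add2l //.
  move: (fl n); rewrite (le_lt_trans ng) ?lt_addr // -El.
  by case: (fac p q n).
have [k sE] := oadd_sub ps.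
have kg : k < g by rewrite -(lt_add2l p) -El -sE.
have [r [kr [rg Gr]]] := lim k kg.
have prq : p +o r < q by rewrite El lt_add2l.
have sr : s <= p +o r by rewrite sE le_add2l ltW.
have fE : fac p q = fac (p +o r) q.
  apply: sle_anti; first by apply: mn; rewrite ?le_addr.
  apply/sleNlt => -[i [_ Li]]; have := fac_isSome (opt_lt_isSome Li).
  rewrite -oaddA El lt_add2l => rig; have ig := le_lt_trans (le_addl r i) rig.
  move: Li; rewrite -shift_fac /shift (per _ rig) omod_addl //.
  by rewrite -per // opt_lt_irrefl.
(* The prime suffix is above the whole by [mn], and below its own suffix at [p +o r], a copy of the
   whole. Being equal to it, the whole is primitive. *)
have zE : fac s q = fac p q.
  apply: sle_anti; last exact: mn.
  by rewrite fE; apply: (prime_fac_min Psq).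
by rewrite zE in zprim; apply: nl; apply: zprim.
Qed.

(** For suffixes starting before [q], minimality of the first factor extends to the union. Later
    ones are compared through the suffix at [p'], which itself starts before [q]. *)
Lemma prime_fac_overlap p q p' q' : prime_fac p q -> prime_fac p' q' ->
  p <= p' -> p' < q -> q <= q' -> prime_fac p q'.
Proof.
move=> P P' pp' p'q qq'; have [q'L p'q' _] := P'.
apply: (prime_of_suffix pp' P') => t pt tq'.
have ext s : p <= s -> s < q -> sle (fac p q') (fac s q').
  by move=> p_s sq; apply: (sle_fac_extend _ sq) => //; apply: prime_fac_min.
case: (ltP t q) => [|qt]; first exact: ext.
apply: (sle_trans (ext p' pp' p'q)); apply: prime_fac_min => //.
by rewrite ltW // (lt_le_trans p'q).
Qed.

(** A suffix at [t] smaller than the whole would differ from it at some offset [r], and a prime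
    [fac s c] reaching past [t] and [s +o r] already excludes this. *)
Lemma prime_fac_sup s e : s < e -> e <= L ->
  (forall b, b < e -> exists c, b < c /\ c <= e /\ prime_fac s c) -> prime_fac s e.
Proof.
move=> se eL cof; have [//|NP] := EM (prime_fac s e).
have mn t : s <= t -> t < e -> sle (fac s e) (fac t e).
  move=> st te; apply/sleNlt => -[r [Er Lr]].
  have sre := fac_isSome (opt_lt_isSome Lr).
  have [c [bc [ce Pc]]] : exists c, Order.max t (s +o r) < c /\ c <= e /\ prime_fac s c.
    by apply: cof; rewrite gt_max te.
  move: bc; rewrite gt_max => /andP[tc src].
  have ta j : isSome (fac t c j) -> fac t e j = fac t c j.
    by move=> /fac_isSome tjc; rewrite !facE // (lt_le_trans tjc).
  have sb j : j <= r -> fac s e j = fac s c j.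
    move=> jr; have sjc : s +o j < c by apply: le_lt_trans src; rewrite le_add2l.
    by rewrite !facE // (lt_le_trans sjc).
  have cL := le_trans ce eL.
  have ssr : isSome (fac s c r) by rewrite isSome_fac.
  have eqr : fac s c r <> fac t c r.
    move=> E; have := ta r; rewrite -E => /(_ ssr) E'.
    by move: Lr; rewrite E' sb // opt_lt_irrefl.
  case: (prime_fac_min Pc st tc) => [E|[r' [Er' Lr']]]; first by rewrite E in eqr.
  have tr' := ta r' (opt_lt_isSome Lr').
  case: (ltgtP r' r) => [r'r|rr'|r'E].
  - by move: Lr'; rewrite -tr' Er // sb ?opt_lt_irrefl // ltW.
  - exact: eqr (Er' _ rr').
  - by move: Lr'; rewrite r'E in tr' *; rewrite -tr' -sb // (opt_ltN Lr).
apply: prime_facI => // n l fl n0 Gl per; apply: contrapT => nl.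
have El := has_len_facE eL se fl.
have nltl : n < l.
  rewrite lt_neqAle; apply/andP; split; first exact/eqP.
  by apply: omult_ge => //; rewrite -(lt_addr s) -El.
have [c [nc [ce Pc]]] : exists c, s +o n < c /\ c <= e /\ prime_fac s c.
  by apply: cof; rewrite El lt_add2l.
have [cL sc [_ [cprim _]]] := Pc.
have [m Em] := oadd_sub (ltW sc).
have ml : m <= l by rewrite -(le_add2l s) -El -Em.
have nm : n < m by rewrite -(lt_add2l s) -Em.
have cm : has_len (fac s c) m by rewrite Em; apply: has_len_fac; rewrite -Em.
have ce' j : j < m -> fac s c j = fac s e j.
  by move=> jm; rewrite !facE ?Em ?El ?lt_add2l // (lt_le_trans jm).
have cper j : j < m -> fac s c j = fac s c (omod n j).
  move=> jm; rewrite !ce' ?(le_lt_trans (le_omod j n0)) // per //.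
  exact: lt_le_trans jm ml.
(* A proper period [n] of the union is also one of [fac s c]. If its length [m] is a multiple of
   [n], primitivity fails; otherwise the incomplete last copy is a suffix smaller than [fac s c]. *)
have [g [Gg [rn Er]]] := omodP m n0; set r := omod n m in rn Er.
have [r0|r0] := ord0_or_pos r.
  have Gm : omult n m by rewrite Er r0 oadd0.
  by move: nm; rewrite (cprim n m) // ltxx.
have gm : g < m by rewrite Er lt_addr.
have /sleNlt[] : sle (fac s c) (fac (s +o g) c).
  by apply: (prime_fac_min Pc); rewrite ?le_addr // Em lt_add2l.
exists r; rewrite -shift_fac /shift; split=> [j jr|].
  rewrite cper ?Er ?lt_add2l // omod_addl // omod_small //.
  exact: lt_trans jr rn.
rewrite -Er [fac s c m]fac_None ?Em //.
by move: (cm r); rewrite (lt_trans rn nm) -Em; case: (fac s c r).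
Qed.

End Fixed.
End Streams.

(** * Tilings by factors *)

Section Tilings.
Context {d : Order.disp_t} {A : orderType d}.
Variables (X : Ord -> option A) (L : Ord).
Hypothesis XL : has_len X L.
Local Notation fac := (sub X).
Local Notation prime_fac := (prime_fac X L).

(** Tiles are given by their endpoints and not by an index, so that two tilings of one word can be
    compared as relations. *)
Record tiling (B : Ord -> Ord -> Prop) : Prop := Tiling {
  tile_lt : forall s e, B s e -> s < e;
  tile_le : forall s e, B s e -> e <= L;
  tile_cover : forall i, i < L -> exists s e, [/\ B s e, s <= i & i < e];
  tile_fun : forall s e e', B s e -> B s e' -> e = e';
  tile_disj : forall s e s' e', B s e -> B s' e' -> s < s' -> e <= s' }.

Section OneTiling.
Variable B : Ord -> Ord -> Prop.
Hypothesis TB : tiling B.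

Lemma tile_cover_from c q i : B c q -> c <= i -> i < L ->
  exists s e, [/\ B s e, c <= s, s <= i & i < e].
Proof.
move=> Bc ci /(tile_cover TB)[s [e [Bs si ie]]]; exists s, e; split=> //.
rewrite leNgt; apply/negP => sc.
by have := tile_disj TB Bs Bc sc; rewrite leNgt (le_lt_trans ci).
Qed.

Lemma tile_next s e : B s e -> e < L -> exists e', B e e'.
Proof.
move=> Bs eL.
have [s' [e' [Bs' ss' s'e ee']]] := tile_cover_from Bs (ltW (tile_lt TB Bs)) eL.
exists e'; suff -> : e = s' by [].
move: ss'; rewrite le_eqVlt => /predU1P[E|ss'].
  by rewrite -E in Bs'; rewrite (tile_fun TB Bs Bs') ltxx in ee'.
by apply/le_anti; rewrite s'e andbT; exact: (tile_disj TB Bs Bs' ss').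
Qed.

Definition cut b := b = L \/ exists e, B b e.

Lemma tile_cut_le s e b : B s e -> cut b -> s < b -> e <= b.
Proof.
move=> Bs [->|[e' Bb]] sb; first exact: (tile_le TB Bs).
exact: (tile_disj TB Bs Bb sb).
Qed.

(** Induction on [g]: either a tile ends at [c +o g] and is the last copy, or tile ends accumulate
    there and [omult_lim] applies. *)
Lemma run_omult n c q g : B c q -> cut (c +o g) ->
  (forall s e, B s e -> c <= s -> s < c +o g -> e = s +o n) -> omult n g.
Proof.
move=> Bc; elim: (olt_wf g) => {}g _ IH Cg run.
have [->|g0] := ord0_or_pos g; first exact: omult0.
have sub_run h : h < g -> cut (c +o h) -> omult n h.
  move=> hg Ch; apply: IH => // s e Bs cs sh; apply: run => //.
  by rewrite (lt_trans sh) // lt_add2l.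
have [[s [Bs cs]]|N] := EM (exists s, B s (c +o g) /\ c <= s).
  have sg := tile_lt TB Bs; have E := run _ _ Bs cs sg.
  have [h sE] := oadd_sub cs; move: E; rewrite sE -oaddA => /oaddI gE.
  rewrite gE; apply: omultS; apply: sub_run; first by rewrite -(lt_add2l c) -sE.
  by right; exists (c +o g); rewrite -sE.
have gL : c +o g <= L.
  case: Cg => [->//|[e Be]].
  by rewrite ltW // (lt_le_trans (tile_lt TB Be)) // (tile_le TB Be).
apply: omult_lim => h hg; have cg : c +o h < c +o g by rewrite lt_add2l.
have [s [e [Bs cs sh he]]] := tile_cover_from Bc (le_addr c h) (lt_le_trans cg gL).
have eg : e < c +o g.
  rewrite lt_neqAle (tile_cut_le Bs Cg (le_lt_trans sh cg)) andbT.
  by apply/eqP => E; apply: N; exists s; rewrite -E.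
have [k eE] := oadd_sub (le_trans cs (ltW (tile_lt TB Bs))).
exists k; rewrite -(lt_add2l c) -eE; split=> //.
have kg : k < g by rewrite -(lt_add2l c) -eE.
split=> //; apply: sub_run => //; rewrite -eE; right.
exact: (tile_next Bs (lt_le_trans eg gL)).
Qed.

Lemma tile_end w n s e : B s e -> fac s e = w -> has_len w n -> e = s +o n.
Proof.
move=> Bs <-; apply: (has_len_facE XL).
- exact: (tile_le TB Bs).
- exact: (tile_lt TB Bs).
Qed.

(** Only the starts of the tiles are bounded by [b]; the last one may reach beyond it. *)
Definition run w c b := forall s e, B s e -> c <= s -> s < b -> fac s e = w.

(** The tile containing [c +o i] starts at [c +o g] with [g] a multiple of [n], so the offset in
    this tile is [i] modulo [n]. *)
Lemma run_pinf w n c q b i : has_len w n -> ozero < n -> B c q -> run w c b ->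
  c +o i < b -> b <= L -> X (c +o i) = pinf n w i.
Proof.
move=> wn n0 Bc cb ib bL.
have [s [e [Bs cs si ie]]] := tile_cover_from Bc (le_addr c i) (lt_le_trans ib bL).
have [g sE] := oadd_sub cs.
have Es := tile_end Bs (cb _ _ Bs cs (le_lt_trans si ib)) wn.
have Gg : omult n g.
  apply: (run_omult Bc); first by right; exists e; rewrite -sE.
  move=> s' e' Bs' cs'; rewrite -sE => s's; apply: (tile_end Bs' _ wn).
  by apply: cb => //; rewrite (lt_trans s's) // (le_lt_trans si).
have [r iE] := oadd_sub si.
have rn : r < n by rewrite -(lt_add2l s) -iE -Es.
have -> : i = g +o r by apply: (@oaddI c); rewrite oaddA -sE.
rewrite /pinf omodE // oaddA -sE -(cb _ _ Bs cs (le_lt_trans si ib)) facE //.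
by rewrite -iE.
Qed.

Hypothesis primeB : forall s e, B s e -> prime_fac s e.

Lemma tile_len s e : B s e ->
  exists n, [/\ ozero < n, e = s +o n & has_len (fac s e) n].
Proof.
move=> Bs; have [n [n0 E]] := oadd_sub_lt (tile_lt TB Bs).
exists n; split=> //; rewrite E; apply: has_len_fac => //; rewrite -E.
exact: (tile_le TB Bs).
Qed.

(** By [pinf_lt_prime] the last tile exceeds the infinite power of [u], first at some offset [i]. A
    suffix starting at a tile at distance [h] before [b] thus leaves this power upwards at [h +o i].
    No start does so later than [c], which makes the suffix at [c] least. *)
Lemma prime_fac_run c q b q' : B c q -> B b q' -> c < b ->
  run (fac c q) c b -> slt (fac c q) (fac b q') -> prime_fac c q'.
Proof.
move=> Bc Bb cb rn uv; set u := fac c q in rn uv.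
have [n [n0 qE un]] := tile_len Bc; rewrite -/u in un.
have bL : b < L := lt_le_trans (tile_lt TB Bb) (tile_le TB Bb).
have q'L := tile_le TB Bb; have bq' := tile_lt TB Bb.
have [m [_ _ vm]] := tile_len Bb; have Pb := primeB Bb.
have [i [Ei Li]] : slt (pinf n u) (fac b q').
  by apply: pinf_lt_prime => //; [case: Pb|exists m].
have rest s e h : B s e -> c <= s -> b = s +o h ->
    [/\ omult n h, forall j, j < h -> fac s q' j = pinf n u j,
        forall j, fac s q' (h +o j) = fac b q' j &
        forall j, pinf n u (h +o j) = pinf n u j].
  move=> Bs cs bE.
  have rs : run u s b by move=> s' e' Bs' /(le_trans cs); apply: rn.
  have Gh : omult n h.
    apply: (run_omult Bs); first by right; exists q'; rewrite -bE.
    move=> s' e' Bs' ss'; rewrite -bE => s'b.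
    exact: (tile_end Bs' (rs _ _ Bs' ss' s'b) un).
  split=> // j; first last.
  - by rewrite /pinf omod_addl.
  - by rewrite /sub oaddA -bE.
  move=> jh; have sjb : s +o j < b by rewrite bE lt_add2l.
  rewrite facE ?(lt_trans sjb) //.
  by apply: (run_pinf un n0 Bs rs sjb); apply: ltW.
have [g bE] := oadd_sub (ltW cb).
have [Gg c1 c2 c3] := rest c q g Bc (lexx c) bE.
have agree s e h : B s e -> c <= s -> b = s +o h ->
    (forall j, j < h +o i -> fac s q' j = pinf n u j).
  move=> Bs cs sE j jhi; have [_ s1 s2 s3] := rest s e h Bs cs sE.
  case: (ltP j h) => [/s1//|/oadd_sub[k jE]].
  by rewrite jE s2 s3 Ei // -(lt_add2l h) -jE.
have tileA s e : B s e -> c <= s -> s <= b -> sle (fac c q') (fac s q').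
  move=> Bs cs /oadd_sub[h sE]; have [Gh s1 s2 s3] := rest s e h Bs cs sE.
  have hg : h <= g.
    have [k kE] := oadd_sub cs; have -> : g = k +o h; last exact: le_addl.
    by apply: (@oaddI c); rewrite oaddA -kE -sE.
  (* By absorption two starts may leave the power at the same offset; the suffixes are then
     equal. *)
  have := le_add2r i hg; rewrite le_eqVlt => /predU1P[E|lt].
    left; apply/funext => j; case: (ltP j (g +o i)) => [jg|/oadd_sub[k jE]].
      by rewrite (agree c q g) // (agree s e h) // E.
    by rewrite jE -oaddA c2 oaddA -E -oaddA s2.
  right; exists (h +o i); rewrite s2 (agree c q g) // s3; split=> // j jh.
  by rewrite (agree c q g) ?(lt_trans jh) // (agree s e h).
apply: (prime_of_suffix XL (ltW cb) Pb) => t ct tq'.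
(* A start inside a tile is compared with the start of that tile, using that the tile is prime. *)
case: (leP b t) => [bt|tb].
  apply: (sle_trans (tileA b q' Bb (ltW cb) (lexx b))).
  exact: (prime_fac_min XL Pb bt tq').
have [s [e [Bs cs st te]]] := tile_cover_from Bc ct (lt_trans tb bL).
have sb := le_lt_trans st tb.
apply: (sle_trans (tileA s e Bs cs (ltW sb))).
apply: (sle_fac_extend XL st te) => //.
  by rewrite (le_trans (tile_disj TB Bs Bb sb)) // ltW.
exact: (prime_fac_min XL (primeB Bs) st te).
Qed.

(** Intervals are closed here, named by their first and last tile, whereas [densely_nonincreasing]
    has half-open ones; [off_dense] makes the passage. *)
Definition dense_tiling := forall c q b e, B c q -> B b e -> c <= b ->
  (forall s e', B s e' -> c <= s -> s <= b -> fac s e' = fac c q) \/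
  exists s e s' e', [/\ B s e, B s' e', c <= s /\ s < s', s' <= b &
                       slt (fac s' e') (fac s e)].

(** The first tile that differs from the one at [c] ends a non-constant interval, in which the only
    possible descent is onto that tile. *)
Lemma run_or_descent c q z : dense_tiling -> B c q ->
  run (fac c q) c z \/
  exists b e, [/\ B b e, c < b, b < z, slt (fac b e) (fac c q) & run (fac c q) c b].
Proof.
move=> D Bc; have [|N] := EM (run (fac c q) c z); first by left.
have [|b [[e [Bb cb bz Nb]] bmin]] :=
  @omin (fun b => exists e, [/\ B b e, c <= b, b < z & fac b e <> fac c q]).
  apply: contrapT => N'; apply: N => s e Bs cs sz; apply: contrapT => Ns.
  by apply: N'; exists s, e.
have rn : run (fac c q) c b.
  move=> s e' Bs cs sb; apply: contrapT => Ns.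
  have: b <= s by apply: bmin; exists e'; split=> //; apply: lt_trans bz.
  by rewrite leNgt sb.
right; exists b, e; split=> //.
  rewrite lt_neqAle cb andbT; apply/eqP => E; apply: Nb; rewrite -E in Bb *.
  by rewrite (tile_fun TB Bb Bc).
case: (D _ _ _ _ Bc Bb cb) => [/(_ _ _ Bb cb (lexx b))//|].
move=> [s [e1 [s' [e2 [Bs Bs' [cs ss'] s'b]]]]].
rewrite (rn _ _ Bs cs (lt_le_trans ss' s'b)) => dsc.
move: s'b; rewrite le_eqVlt => /predU1P[E|s'b].
  by rewrite -E in Bb *; rewrite (tile_fun TB Bb Bs').
by move: dsc; rewrite (rn _ _ Bs') ?(le_trans cs (ltW ss')) // => /slt_irrefl.
Qed.

Lemma dense_tile_maximal c q q' : dense_tiling -> B c q -> prime_fac c q' ->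
  ~ q < q'.
Proof.
move=> D Bc Pv qq'; have [q'L cq' [_ [vprim _]]] := Pv.
have [n [n0 qE un]] := tile_len Bc; set u := fac c q in un.
case: (run_or_descent q' D Bc) => [rn|[b1 [e1 [Bb1 cb1 b1q' lt1 _]]]].
  have Xu j : c +o j < q' -> X (c +o j) = pinf n u j.
    by move=> jq'; apply: (run_pinf un n0 Bc rn jq' q'L).
  have [g q'E] := oadd_sub (ltW cq').
  (* Without a descent, [q'] either falls between tiles, which makes [fac c q'] a proper power, or
     cuts a copy of [u], whose initial fragment is then a suffix that is too small. *)
  have [Cq'|NC] := EM (cut q').
    have Gg : omult n g.
      apply: (run_omult Bc); rewrite -q'E // => s e Bs cs sq'.
      exact: (tile_end Bs (rn _ _ Bs cs sq') un).
    have ng : n = g.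
      have vg : has_len (fac c q') g.
        by rewrite q'E; apply: (has_len_fac XL); rewrite -q'E.
      apply: (vprim _ _ vg n0 Gg).
      move=> i ig. have im := le_lt_trans (le_omod i n0) ig.
      rewrite !facE ?q'E ?lt_add2l // !Xu ?q'E ?lt_add2l //.
      by rewrite /pinf [in RHS]omod_small //; have [h [_ []]] := omodP i n0.
    by move: qq'; rewrite qE q'E ng ltxx.
  have q'L' : q' < L by rewrite lt_neqAle q'L andbT; apply/eqP => E; apply: NC; left.
  have [s [e [Bs cs sq' q'e]]] := tile_cover_from Bc (ltW cq') q'L'.
  have {}sq' : s < q'.
    rewrite lt_neqAle sq' andbT; apply/eqP => E; apply: NC; right.
    by exists e; rewrite -E.
  have su := rn _ _ Bs cs sq'; have eE := tile_end Bs su un.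
  have [m mE] := oadd_sub (ltW sq').
  have mn : m < n by rewrite -(lt_add2l s) -mE -eE.
  have uv j : j < n -> u j = fac c q' j.
    move=> jn; have cj : c +o j < q by rewrite qE lt_add2l.
    by rewrite /u !facE // (lt_trans cj).
  have /sleNlt[] := prime_fac_min XL Pv cs sq'.
  exists m; split=> [j jm|].
    rewrite -uv ?(lt_trans jm) // /u -su.
    by rewrite !facE ?mE ?eE ?lt_add2l // (lt_trans jm).
  rewrite -uv // fac_None ?mE //.
  by have := un m; rewrite mn; case: (u m).
have [|m [[b [e [Bb cb bq' Em dsc]]] mmin]] := @omin (fun m =>
    exists b e, [/\ B b e, c <= b, b < q', e = b +o m & slt (fac b e) u]).
  have [m [_ E _]] := tile_len Bb1.
  by exists m, b1, e1; rewrite (ltW cb1).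
have [m' [m0 Em' wm]] := tile_len Bb; set w := fac b e in wm dsc.
have mE : m' = m by apply: (@oaddI b); rewrite -Em -Em'.
rewrite {}mE {Em'} in m0 wm.
have inf_u : slt (pinf m w) u.
  by apply: pinf_lt_prime => //; [case: (primeB Bc)|exists n].
(* The contradiction is the cycle [u <= fac c q' <= fac b q' <= pinf m w < u]; the third inequality
   remains after two steps. *)
apply: (@slt_irrefl _ _ u); apply: sle_lt_trans inf_u.
apply: (sle_trans (sle_fac_prefix X c (ltW qq'))).
apply: (sle_trans (prime_fac_min XL Pv cb bq')).
apply/sleNlt => -[i [Ei Li]]; have biq' := fac_isSome (opt_lt_isSome Li).
case: (run_or_descent q' D Bb) => [rn|[b2 [e2 [Bb2 bb2 b2q' [r [Er Lr]] rn]]]].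
  move: Li; rewrite facE // (run_pinf wm m0 Bb rn biq' q'L).
  by rewrite opt_lt_irrefl.
have b2L : b2 <= L by rewrite ltW // (lt_le_trans (tile_lt TB Bb2)) ?(tile_le TB Bb2).
have [h hE] := oadd_sub (ltW bb2).
have Gh : omult m h.
  apply: (run_omult Bb); rewrite -hE; first by right; exists e2.
  by move=> s e' Bs bs sb2; apply: (tile_end Bs (rn _ _ Bs bs sb2) wm).
have rm : r < m by rewrite -wm (opt_lt_isSome Lr).
have [l [_ e2E w2l]] := tile_len Bb2.
(* As [w] is shortest, the next smaller tile is at least as long, so the offset [r] of their
   difference lies inside it and shows in the letters of [X]. *)
have ml : m <= l.
  apply: mmin; exists b2, e2; split=> //; first exact: le_trans cb (ltW bb2).
  by apply: slt_trans dsc; exists r.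
have b2r : b2 +o r < e2 by rewrite e2E lt_add2l (lt_le_trans rm).
have Xr j : j <= r -> X (b +o (h +o j)) = fac b2 e2 j.
  by move=> jr; rewrite oaddA -hE facE // (le_lt_trans _ b2r) // le_add2l.
have pr j : j <= r -> pinf m w (h +o j) = w j.
  by move=> jr; rewrite /pinf omodE // (le_lt_trans jr).
have agree j : j < h +o r -> X (b +o j) = pinf m w j.
  move=> jhr; case: (ltP j h) => [jh|/oadd_sub[k jE]].
    by apply: (run_pinf wm m0 Bb rn) => //; rewrite hE lt_add2l.
  have kr : k < r by rewrite -(lt_add2l h) -jE.
  by rewrite jE Xr ?(ltW kr) // pr ?(ltW kr) // Er.
(* The suffix at [b] first leaves the power of [w] at [h +o r], and downwards, so [i] cannot be a
   first difference upwards. *)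
case: (ltgtP i (h +o r)) => [ir|ri|iE].
- by move: Li; rewrite facE // agree // opt_lt_irrefl.
- have := Ei _ ri; rewrite facE; last by rewrite (lt_trans _ biq') // lt_add2l.
  by rewrite pr // Xr // => E; move: Lr; rewrite -/w E opt_lt_irrefl.
- by move: Li; rewrite facE // iE pr // Xr // (opt_ltN Lr).
Qed.

End OneTiling.

(** Induction on the start [s]. The tile of the other tiling that contains [s] cannot start earlier,
    since by induction it would belong to both and overlap; starting at [s], it has the same end by
    [dense_tile_maximal] applied both ways. *)
Lemma dense_tiling_uniq B B' : tiling B -> tiling B' ->
  (forall s e, B s e -> prime_fac s e) -> (forall s e, B' s e -> prime_fac s e) ->
  dense_tiling B -> dense_tiling B' -> forall s e, B s e <-> B' s e.
Proof.
move=> T T' P P' D D' s; elim: (olt_wf s) => {}s _ IH.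
have H C C' : tiling C -> tiling C' ->
  (forall s e, C s e -> prime_fac s e) -> (forall s e, C' s e -> prime_fac s e) ->
  dense_tiling C -> dense_tiling C' ->
  (forall t, t < s -> forall e, C' t e -> C t e) -> forall e, C s e -> C' s e.
  move=> {T T' P P' D D' IH} T T' P P' D D' IH e Cs.
  have sL := lt_le_trans (tile_lt T Cs) (tile_le T Cs).
  have [t [e' [Ct ts se']]] := tile_cover T' sL.
  move: ts; rewrite le_eqVlt => /predU1P[E|ts].
    rewrite E in Ct; case: (ltgtP e e') => [ee'|e'e|->//].
      by case: (dense_tile_maximal T P D Cs (P' _ _ Ct)).
    by case: (dense_tile_maximal T' P' D' Ct (P _ _ Cs)).
  by have := tile_disj T (IH _ ts _ Ct) Cs ts; rewrite leNgt se'.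
move=> e; split; apply: H => // t ts e'; first by move=> /(IH t ts).
by move=> /(IH t ts).
Qed.

(** * The tiling by maximal prime factors *)

Lemma prime_fac_letter i : i < L -> prime_fac i (i +o oone).
Proof.
move=> iL; have eL := add1_le iL.
have ie : i < i +o oone by rewrite lt_addr lt1o.
apply: (prime_facI XL) => // [n l fl n0 Gl _|t it tq].
  have := has_len_facE XL eL ie fl => /oaddI lE; rewrite -lE in Gl *.
  have o1 : ozero < oone by rewrite lt1o.
  apply/le_anti; rewrite (omult_ge n0 Gl o1).
  by apply: le_ext => z; rewrite lt1o => /eqP ->.
have [k kE] := oadd_sub it; move: tq; rewrite kE lt_add2l lt1o => /eqP ->.
by rewrite oadd0; left.
Qed.

(** Maximality is tested against the prime factors containing position [s]; [max_prime_facP] extends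
    it to all that overlap the factor. *)
Definition max_prime_fac s e := prime_fac s e /\
  forall s' e', prime_fac s' e' -> s' <= s -> s < e' -> s <= s' /\ e' <= e.

Lemma max_prime_facP s e s' e' : max_prime_fac s e -> prime_fac s' e' ->
  s' < e -> s < e' -> s <= s' /\ e' <= e.
Proof.
move=> [P M] P' s'e se'; case: (leP s' s) => [s's|ss']; first exact: M.
split; first exact: ltW.
case: (leP e' e) => // ee'.
have PU := prime_fac_overlap XL P P' (ltW ss') s'e (ltW ee').
by have [_] := M _ _ PU (lexx s) se'; rewrite leNgt ee'.
Qed.

(** Among the prime factors containing [i], such as a single letter, take the least start [s], then
    the supremum of the ends of prime factors from [s]. A competitor contains [i], or its union with
    this factor does, so it cannot start before [s]. *)
Lemma max_prime_cover i : i < L -> exists s e, [/\ max_prime_fac s e, s <= i & i < e].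
Proof.
move=> iL.
have [|s [[e0 [P0 si ie0]] smin]] :=
  @omin (fun s => exists e, [/\ prime_fac s e, s <= i & i < e]).
  exists i, (i +o oone); rewrite lexx lt_addr lt1o eqxx; split=> //.
  exact: prime_fac_letter.
have [|e [ub cof]] := @olub (fun e => prime_fac s e) L; first by move=> a [].
have e0e := ub _ P0; have [e0L se0 _] := P0.
have eL : e <= L by apply: le_ext => z /cof[a [[aL _ _] za]]; exact: lt_le_trans aL.
have P : prime_fac s e.
  apply: prime_fac_sup => //; first exact: lt_le_trans e0e.
  by move=> b /cof[a [Pa ba]]; exists a; split=> //; split=> //; apply: ub.
have ie : i < e := lt_le_trans ie0 e0e.
exists s, e; split=> //; split=> // s' e' P' s's se'.
case: (leP e' e) => [e'e|ee'].
  split=> //; case: (leP e' i) => [e'i|ie'].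
    have PU := prime_fac_overlap XL P' P s's se' e'e.
    by apply: smin; exists e; split=> //; apply: le_trans si.
  by apply: smin; exists e'; split=> //; apply: le_trans si.
have ss' : s <= s'.
  by apply: smin; exists e'; split=> //; [apply: le_trans si|apply: lt_trans ee'].
have E : s' = s by apply/le_anti; rewrite ss' s's.
by rewrite E in P'; have := ub _ P'; rewrite leNgt ee'.
Qed.

Lemma max_prime_tiling : tiling max_prime_fac.
Proof.
split.
- by move=> s e [[_ ?]].
- by move=> s e [[?]].
- exact: max_prime_cover.
- move=> s e e' M M'; have [[_ se _] _] := M; have [[_ se' _] _] := M'.
  have [_ l1] := max_prime_facP M M'.1 se se'.
  have [_ l2] := max_prime_facP M' M.1 se' se.
  by apply/le_anti; rewrite l1 l2.
- move=> s e s' e' M M' ss'; have [[_ se' _] _] := M'; rewrite leNgt; apply/negP => s'e.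
  have [] := max_prime_facP M' M.1 (lt_trans ss' se') s'e.
  by rewrite leNgt ss'.
Qed.

Lemma max_prime_no_ascent c q b q' : max_prime_fac c q -> max_prime_fac b q' ->
  c < b -> run max_prime_fac (fac c q) c b -> ~ slt (fac c q) (fac b q').
Proof.
move=> Mc Mb cb rn lt.
have P := prime_fac_run max_prime_tiling (fun s e => @proj1 _ _) Mc Mb cb rn lt.
have [[_ bq' _] _] := Mb.
have [_] := Mc.2 _ _ P (lexx c) (lt_trans cb bq').
by rewrite leNgt (le_lt_trans _ bq') // (tile_disj max_prime_tiling Mc Mb cb).
Qed.

End Tilings.

(** * Words as streams *)

Arguments plt_irrefl {c x} _.
Arguments plt_trans {c x y z} _ _.
Arguments plt_total {c} x y.
Arguments plt_wf {c} _.

(* The order type of the positions before [p]. *)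
Definition rank (a : cwo) : a -> Ord := Fix (@plt_wf a) (fun _ => Ord)
  (fun p rec => osup (fun s : {q | plt q p} => rec (sval s) (svalP s))).

Lemma rankE (a : cwo) (p : a) :
  rank p = osup (fun s : {q | plt q p} => rank (sval s)).
Proof.
rewrite /rank Fix_eq //= => {}p f g fg.
by congr osup; apply/funext => s.
Qed.

Lemma rank_mono (a : cwo) (p q : a) : plt p q -> rank p < rank q.
Proof. by move=> pq; rewrite (rankE q); apply/lt_osup; exists (exist _ p pq). Qed.

Lemma plt_rank (a : cwo) (p q : a) : plt p q <-> rank p < rank q.
Proof.
split; first exact: rank_mono.
case: (plt_total p q) => [->|[//|/rank_mono/lt_trans/[apply]]]; by rewrite ltxx.
Qed.

Lemma rank_inj (a : cwo) : injective (@rank a).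
Proof.
by move=> p q E; case: (plt_total p q) => [//|[]] /rank_mono; rewrite E ltxx.
Qed.

Lemma rank_initial (a : cwo) (p : a) i : i < rank p -> exists q : a, rank q = i.
Proof.
elim: (plt_wf p) => {}p _ IH; rewrite rankE => /lt_osup[[q qp]] /=.
by rewrite le_eqVlt => /predU1P[->|/(IH q qp)//]; exists q.
Qed.

Definition len (a : cwo) : Ord := osup (@rank a).

Lemma lt_len (a : cwo) i : i < len a <-> exists p : a, rank p = i.
Proof.
split=> [/lt_osup[p]|[p <-]]; last by apply/lt_osup; exists p.
by rewrite le_eqVlt => /predU1P[->|/rank_initial//]; exists p.
Qed.

Lemma rank_len (a : cwo) (p : a) : rank p < len a.
Proof. by apply/lt_len; exists p. Qed.

(** Uniqueness of the collapse of a well-order onto an initial segment of the ordinals; it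
    identifies ranks inside products and sums. *)
Lemma rank_uniq (a : cwo) (r : a -> Ord) : (forall p q, plt p q -> r p < r q) ->
  (forall p i, i < r p -> exists q, r q = i) -> forall p, r p = rank p.
Proof.
move=> mono init p; elim: (plt_wf p) => {}p _ IH.
apply/le_anti/andP; split; apply: le_ext => z.
  move=> /[dup] zp /init[q qz]; rewrite -qz in zp *.
  have qp : plt q p.
    case: (plt_total q p) => [E|[//|/mono]]; first by rewrite E ltxx in zp.
    by move/(lt_trans zp); rewrite ltxx.
  by rewrite IH // rank_mono.
move=> /[dup] zp /rank_initial[q qz]; rewrite -qz in zp *.
by have qp := (plt_rank q p).2 zp; rewrite -IH // mono.
Qed.

Section WordStreams.
Context {d : Order.disp_t} {A : orderType d}.
Implicit Types w x y z : word A.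
Local Notation wl w := (len (wlen w)).

Definition strm w : Ord -> option A := fun i =>
  match pselect (exists p : wlen w, rank p = i) with
  | left h => Some (wlab w (sval (cid h)))
  | right _ => None
  end.

Lemma strm_rank w p : strm w (rank p) = Some (wlab w p).
Proof.
rewrite /strm; case: pselect => [h|[]]; last by exists p.
by rewrite (rank_inj (svalP (cid h))).
Qed.

Lemma strm_len w : has_len (strm w) (wl w).
Proof.
move=> i; rewrite /strm; case: pselect => [h|N] /=.
  by apply/esym/lt_len.
by apply/esym/negbTE/negP => /lt_len.
Qed.

Lemma strm_eq w f : has_len f (wl w) ->
  (forall p, f (rank p) = Some (wlab w p)) -> f = strm w.
Proof.
move=> fl fE; apply/funext => i; case: (ltP i (wl w)) => [/lt_len[p <-]|li].
  by rewrite fE strm_rank.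
by rewrite (has_len_None fl li) (has_len_None (@strm_len w) li).
Qed.

(** The bridge from isomorphisms to streams: once the model order [T] is embedded by [r] onto the
    ordinals below [l], an isomorphism with [w] must match [r] with [rank]. *)
Lemma realizes_strm w (T : Type) (lt : T -> T -> Prop) (lab : T -> A)
    (r : T -> Ord) l :
  (forall s t, lt s t <-> r s < r t) -> injective r ->
  (forall i, i < l <-> exists t, r t = i) ->
  realizes w lt lab <-> has_len (strm w) l /\ forall t, strm w (r t) = Some (lab t).
Proof.
move=> ltr rI lr; split=> [[f [fbij [fmono flab]]]|[wl_l wlab_t]].
  have [g fK gK] := fbij.
  have fr : forall p, r (f p) = rank p.
    apply: (@rank_uniq _ (fun p => r (f p))) => [p q|p i ip].
      by rewrite fmono ltr.
    have [t ti] : exists t, r t = i.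
      by apply/lr; apply: lt_trans ip _; apply/lr; exists (f p).
    by exists (g t); rewrite gK.
  split=> [i|t]; last by rewrite -[t]gK fr strm_rank flab.
  rewrite strm_len; apply/idP/idP => [/lt_len[p <-]|/lr[t <-]].
    by apply/lr; exists (f p).
  by apply/lt_len; exists (g t); rewrite -fr gK.
have f_ex (p : wlen w) : exists t, r t = rank p by apply/lr; rewrite -wl_l strm_rank.
have g_ex t : exists p : wlen w, rank p = r t.
  by apply/lt_len; rewrite -strm_len wlab_t.
pose f p := sval (cid (f_ex p)); pose g t := sval (cid (g_ex t)).
have fP p : r (f p) = rank p := svalP (cid (f_ex p)).
have gP t : rank (g t) = r t := svalP (cid (g_ex t)).
exists f; split; last split.
- exists g => [p|t]; first by apply: rank_inj; rewrite gP fP.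
  by apply: rI; rewrite fP gP.
- by move=> p q; rewrite ltr !fP; apply: plt_rank.
- by move=> p; have := wlab_t (f p); rewrite fP strm_rank => -[].
Qed.

Lemma word_eqE w w' : word_eq w w' <-> strm w = strm w'.
Proof.
have -> : word_eq w w' <-> realizes w (@plt (wlen w')) (wlab w').
  split=> [[f [[fb fm] fl]]|[f [fb [fm fl]]]]; exists f.
    by split=> //; split=> // p; rewrite fl.
  by split.
rewrite (@realizes_strm _ _ _ _ (@rank (wlen w')) (wl w')).
- split=> [[l E]|->]; first exact: strm_eq.
  by split=> [|p]; [apply: strm_len|rewrite strm_rank].
- exact: plt_rank.
- exact: rank_inj.
- exact: lt_len.
Qed.

Lemma sub_full w : sub (strm w) ozero (wl w) = strm w.
Proof.
apply/funext => i; rewrite /sub add0o; case: ltP => // li.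
by rewrite (has_len_None (@strm_len w) li).
Qed.

Lemma restr_strm w (S : wlen w -> Prop) y p q : p <= q -> q <= wl w ->
  (forall r, S r <-> p <= rank r /\ rank r < q) ->
  restr w S y <-> strm y = sub (strm w) p q.
Proof.
move=> /oadd_sub[l qE] qw SE.
have r_ex (s : {r | S r}) : exists k, rank (sval s) = p +o k.
  by have /SE[/oadd_sub] := svalP s.
pose r s := sval (cid (r_ex s)).
have rP s : rank (sval s) = p +o r s := svalP (cid (r_ex s)).
rewrite /restr (@realizes_strm _ _ _ _ r l).
- have fl : has_len (sub (strm w) p q) l.
    by rewrite qE; apply: (has_len_fac (@strm_len w)); rewrite -qE.
  split=> [[yl yE]|->].
    apply/funext => i; case: (ltP i l) => [il|li]; last first.
      by rewrite !(has_len_None _ li).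
    have piq : p +o i < q by rewrite qE lt_add2l.
    have [t tE] : exists t : wlen w, rank t = p +o i.
      by apply/lt_len; apply: lt_le_trans qw.
    have St : S t by apply/SE; rewrite tE le_addr.
    have ri : r (exist _ t St) = i by apply: (@oaddI p); rewrite -rP.
    by rewrite -{1}ri yE /sub piq -tE strm_rank.
  split=> // t; rewrite /sub -rP strm_rank.
  by have /SE[_ ->] := svalP t.
- by move=> s t; rewrite plt_rank !rP lt_add2l.
- move=> s t E; have : sval s = sval t by apply: rank_inj; rewrite !rP E.
  by case: s t {E} => s Ss [t St] /= E; apply: eq_exist.
- move=> i; split=> [il|[s <-]]; last first.
    by rewrite -(lt_add2l p) -rP -qE; have /SE[] := svalP s.
  have piq : p +o i < q by rewrite qE lt_add2l.
  have [t tE] : exists t : wlen w, rank t = p +o i.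
    by apply/lt_len; apply: lt_le_trans qw.
  have St : S t by apply/SE; rewrite tE le_addr.
  by exists (exist _ t St); apply: (@oaddI p); rewrite -rP.
Qed.

Definition sub_cwo (a : cwo) (S : a -> Prop) : cwo.
Proof.
refine (@CWO {p | S p} (fun s t => plt (sval s) (sval t)) _ _ _ _ _).
- by move=> s; apply: plt_irrefl.
- by move=> s t u; apply: plt_trans.
- move=> [s Ss] [t St]; case: (plt_total s t) => [E|]; [left|by right].
  exact: eq_exist.
- move=> s; have [p] : exists p, sval s = p by exists (sval s).
  elim: (plt_wf p) s => {}p _ IH s sp; constructor=> t ts.
  by apply: (IH (sval t)) => //; rewrite -sp.
- have [f fI] := pos_countable a; exists (fun s => f (sval s)).
  by move=> [s Ss] [t St] /fI /= E; apply: eq_exist.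
Defined.

Lemma fac_word w p q : p <= q -> q <= wl w -> exists y, strm y = sub (strm w) p q.
Proof.
move=> pq qw; pose S (r : wlen w) := p <= rank r /\ rank r < q.
exists (Word (sub_cwo S) (fun s => wlab w (sval s))).
apply/(@restr_strm _ S _ _ _ pq qw) => //.
by exists id; split; [exists id|].
Qed.

Lemma is_catE x y z : is_cat x y z <->
  [/\ has_len (strm x) (wl y +o wl z),
      forall i, i < wl y -> strm x i = strm y i &
      forall i, strm x (wl y +o i) = strm z i].
Proof.
pose r (s : wlen y + wlen z) :=
  match s with inl p => rank p | inr q => wl y +o rank q end.
rewrite /is_cat (@realizes_strm _ _ _ _ r (wl y +o wl z)).
- split=> [[xl xE]|[xl xy xz]].
    split=> // [i /lt_len[p <-]|i]; first by rewrite (xE (inl p)) strm_rank.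
    case: (ltP i (wl z)) => [/lt_len[q <-]|li]; first by rewrite (xE (inr q)) strm_rank.
    by rewrite (has_len_None (@strm_len z) li) (has_len_None xl) // le_add2l.
  split=> // -[p|q] /=; first by rewrite xy ?rank_len // strm_rank.
  by rewrite xz strm_rank.
- move=> [p|p] [q|q] /=.
  + exact: plt_rank.
  + by split=> // _; apply: lt_le_trans (rank_len p) (le_addr _ _).
  + split=> // lt; have := lt_trans lt (rank_len q).
    by rewrite ltNge le_addr.
  + by rewrite lt_add2l; apply: plt_rank.
- move=> [p|p] [q|q] /= E.
  + by rewrite (rank_inj E).
  + by have := rank_len p; rewrite E ltNge le_addr.
  + by have := rank_len q; rewrite -E ltNge le_addr.
  + by rewrite (rank_inj (oaddI E)).
- move=> i; split=> [|[[p|p] <-]] /=.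
  + move=> /lt_oadd[/lt_len[p <-]|[c [cz ic]]]; first by exists (inl p).
    case: (ltP i (wl y)) => [/lt_len[p <-]|/oadd_sub[k kE]]; first by exists (inl p).
    have /lt_len[q qk] : k < wl z.
      by apply: le_lt_trans cz; rewrite -(le_add2l (wl y)) -kE.
    by exists (inr q); rewrite /= qk.
  + exact: lt_le_trans (rank_len p) (le_addr _ _).
  + by rewrite lt_add2l; apply: rank_len.
Qed.

Lemma strm_letter (a : A) : strm (letter a) ozero = Some a /\ wl (letter a) = oone.
Proof.
have r0 : rank (tt : unit_cwo) = ozero.
  apply/le_anti; rewrite le0o andbT; apply: le_ext => z.
  by move=> /[dup] zr /rank_initial[[] zE]; rewrite -zE ltxx in zr.
rewrite -r0 strm_rank; split=> //; apply/le_anti/andP; split; apply: le_ext => z.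
  by move=> /lt_len[[] <-]; rewrite lt1o r0.
by rewrite lt1o => /eqP->; rewrite -r0 rank_len.
Qed.

Lemma is_prefixE y x : is_prefix y x <->
  exists q, q <= wl x /\ strm y = sub (strm x) ozero q.
Proof.
have E p : restr x (fun q : wlen x => plt q p) y <->
    strm y = sub (strm x) ozero (rank p).
  apply: restr_strm => [||q]; rewrite ?le0o //; first exact: ltW (rank_len p).
  by rewrite plt_rank; split=> [|[]].
have E' : restr x (fun q : wlen x => True) y <->
    strm y = sub (strm x) ozero (wl x).
  by apply: restr_strm => [||q]; rewrite ?le0o // rank_len.
split=> [[[p /E ->]|/E' ->]|[q []]].
- by exists (rank p); rewrite ltW // rank_len.
- by exists (wl x); rewrite lexx.
rewrite le_eqVlt => /predU1P[->|/lt_len[p <-]] H; first by right; apply/E'.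
by left; exists p; apply/E.
Qed.

Lemma str_lt_slt x x' : str_lt x x' -> slt (strm x) (strm x').
Proof.
move=> [a [b [y [z [z' [w [w' [ab [wya [xwz [wyb xwz']]]]]]]]]]].
have H c u v t : is_cat u y (letter c) -> is_cat v u t ->
    (forall i, i < wl y -> strm v i = strm y i) /\ strm v (wl y) = Some c.
  move=> /is_catE[ul uy uc] /is_catE[vl vu vt].
  have [c0 c1] := strm_letter c.
  have yu : wl y < wl u.
    by rewrite (has_len_uniq (@strm_len u) ul) lt_addr c1 lt1o.
  split=> [i iy|]; first by rewrite vu ?uy // (lt_trans iy).
  by rewrite vu // -[X in strm u X]oadd0 uc.
have [x1 x2] := H _ _ _ _ wya xwz; have [y1 y2] := H _ _ _ _ wyb xwz'.
by exists (wl y); rewrite x2 y2; split=> // j jy; rewrite x1 ?y1.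
Qed.

(** Splits [x] around position [i], giving the witnesses that [str_lt] asks for. *)
Lemma cat_letter x i a : strm x i = Some a ->
  exists y w z,
    [/\ is_cat w y (letter a), is_cat x w z & strm y = sub (strm x) ozero i].
Proof.
move=> xi; have il : i < wl x by rewrite -strm_len xi.
have i1 : i < i +o oone by rewrite lt_addr lt1o.
have i1l := add1_le il.
have [y yE] := fac_word (le0o i) (ltW il).
have [w wE] := fac_word (le0o (i +o oone)) i1l.
have [z zE] := fac_word i1l (lexx _).
have [k kE] := oadd_sub i1l.
have wl_fac u p l : p +o l <= wl x -> strm u = sub (strm x) p (p +o l) -> wl u = l.
  move=> pl E; apply: (has_len_uniq (@strm_len u)); rewrite E.
  exact: (has_len_fac (@strm_len x)).
have yl : wl y = i by apply: (@wl_fac _ ozero); rewrite add0o // ltW.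
have wll : wl w = i +o oone by apply: (@wl_fac _ ozero); rewrite add0o.
have zl : wl z = k by apply: (@wl_fac _ (i +o oone)); rewrite -kE.
have [a0 a1] := strm_letter a.
exists y, w, z; split=> //; apply/is_catE; split.
- by rewrite yl a1 -wll; apply: strm_len.
- move=> j; rewrite yl => ji; rewrite wE yE /sub add0o ji.
  by rewrite (lt_trans ji).
- move=> j; rewrite yl wE /sub add0o lt_add2l; case: ifPn => [|N].
    by rewrite lt1o => /eqP->; rewrite oadd0 xi a0.
  by rewrite (has_len_None (@strm_len (letter a))) // a1 leNgt.
- by rewrite wll zl -kE; apply: strm_len.
- by move=> j; rewrite wll wE /sub add0o => ->.
- move=> j; rewrite wll zE /sub; case: ltP => // lj.
  by rewrite (has_len_None (@strm_len x) lj).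
Qed.

Lemma lex_leE x x' : lex_le x x' <-> sle (strm x) (strm x').
Proof.
split=> [[/is_prefixE[q [ql E]]|/str_lt_slt]|]; last 1 first.
- case=> [E|[i [Ei Li]]].
    by left; apply/is_prefixE; exists (wl x'); rewrite sub_full.
  case xi : (strm x i) => [a|].
    case x'i : (strm x' i) => [b|]; last by rewrite x'i in Li.
    right; have [y [w [z [c1 c2 yE]]]] := cat_letter xi.
    have [y' [w' [z' [c1' c2' yE']]]] := cat_letter x'i.
    have E : strm y' = strm y.
      rewrite yE yE'; apply/funext => j; rewrite /sub add0o; case: ifP => // ji.
      by rewrite Ei.
    have yl : wl y' = wl y.
      by apply: (has_len_uniq (@strm_len y')); rewrite E; apply: strm_len.
    exists a, b, y, z, z', w, w'; rewrite xi x'i in Li; do 4!split=> //.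
    by move/is_catE: c1'; rewrite yl E => ?; apply/is_catE.
  (* With no letter at the first difference, [x] ends at [i]. *)
  left; apply/is_prefixE; exists i.
  have ix' : i < wl x' by rewrite -strm_len (opt_lt_isSome Li).
  split; first exact: ltW.
  apply/funext => j; rewrite /sub add0o; case: ltP => [/Ei//|ij].
  apply: (has_len_None (@strm_len x)); apply: le_trans ij.
  by rewrite leNgt -strm_len xi.
- by rewrite E -{2}(sub_full x'); apply: sle_fac_prefix.
- by right.
Qed.

Lemma lex_ltE x x' : lex_lt x x' <-> slt (strm x) (strm x').
Proof.
rewrite /lex_lt lex_leE word_eqE; split=> [[[//|//]]|lt].
by split; [right|move=> E; rewrite E in lt; case: (slt_irrefl lt)].
Qed.

(** * Products and tilings *)

(** Proof irrelevance stands in for decidable equality on the index type. *)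
Lemma existT_inj (T : Type) (P : T -> Type) (x : T) (p q : P x) :
  existT P x p = existT P x q -> p = q.
Proof.
move=> E; have := projT2_eq E.
by rewrite (Prop_irrelevance (projT1_eq E) erefl).
Qed.

Lemma sig_lt_same (J : cwo) (u : J -> word A) j (p q : wlen (u j)) :
  sig_lt u (existT _ j p) (existT _ j q) <-> plt p q.
Proof.
split=> [[/plt_irrefl//|[j' [p' [q' [E1 [E2 pq]]]]]]|pq]; last by right; exists j, p, q.
have Ej := projT1_eq E1; rewrite /= in Ej; move: p' q' E1 E2 pq; case: j' / Ej => p' q'.
by move=> E1 E2; rewrite (existT_inj E1) (existT_inj E2).
Qed.

Lemma sig_lt_proj (J : cwo) (u : J -> word A) s t :
  sig_lt u s t -> ple (projT1 s) (projT1 t).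
Proof. by case=> [|[j [p [q [-> [-> _]]]]]]; [right|left]. Qed.

(* [c j] is the position of [x] at which the factor [u j] starts. *)
Record offsets (J : cwo) (u : J -> word A) x (c : J -> Ord) : Prop := Offsets {
  off_lt : forall j k, plt j k -> c j +o wl (u j) <= c k;
  off_cover : forall i, i < wl x <-> exists j k, k < wl (u j) /\ i = c j +o k;
  off_strm : forall j k, k < wl (u j) -> strm x (c j +o k) = strm (u j) k }.

Lemma prod_of_offsets (J : cwo) (u : J -> word A) x c : offsets u x c -> is_prod u x.
Proof.
move=> [clt ccov cstrm].
pose r (s : {j : J & wlen (u j)}) := c (projT1 s) +o rank (projT2 s).
have rlt j k (p : wlen (u j)) (q : wlen (u k)) :
    plt j k -> r (existT _ j p) < r (existT _ k q).
  move=> /clt jk; rewrite /r /=; apply: lt_le_trans (le_addr _ _).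
  by apply: lt_le_trans jk; rewrite lt_add2l rank_len.
apply/(@realizes_strm _ _ _ _ r (wl x)).
- move=> [j p] [k q]; case: (plt_total j k) => [E|[jk|kj]].
  + move: q; case: k / E => q; rewrite sig_lt_same /r /= lt_add2l; exact: plt_rank.
  + by split=> [_|_]; [apply: rlt|left].
  + split=> [/sig_lt_proj/= [E|/(plt_trans kj)/plt_irrefl//]|].
      by rewrite E in kj; case: (plt_irrefl kj).
    by move/(lt_trans (rlt _ _ q p kj)); rewrite ltxx.
- move=> [j p] [k q] E; case: (plt_total j k) => [Ej|[jk|kj]].
  + by move: q E; case: k / Ej => q; rewrite /r /= => /oaddI/rank_inj->.
  + by have := rlt _ _ p q jk; rewrite E ltxx.
  + by have := rlt _ _ q p kj; rewrite E ltxx.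
- move=> i; rewrite ccov; split=> [[j [k [/lt_len[p <-] ->]]]|[[j p] <-]].
    by exists (existT _ j p).
  by exists j, (rank p); rewrite rank_len.
- split=> [|[j p]]; first exact: strm_len.
  by rewrite /r /= cstrm ?rank_len // strm_rank.
Qed.

(** A nonempty factor has a first letter, whose rank in [x] is the offset. The positions of one
    factor are consecutive in [x], so by [rank_uniq] subtracting the offset gives the rank inside
    the factor. *)
Lemma offsets_of_prod (J : cwo) (u : J -> word A) x : is_prod u x ->
  (forall j, ozero < wl (u j)) -> exists c, offsets u x c.
Proof.
move=> [f [[g fK gK] [fm fl]]] une.
have e_ex j : exists p : wlen (u j), rank p = ozero by apply/lt_len.
pose e j := sval (cid (e_ex j)); have e0 j : rank (e j) = ozero := svalP (cid (e_ex j)).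
pose r s := rank (g s); pose c j := r (existT _ j (e j)).
have rlt s t : sig_lt u s t <-> r s < r t.
  by rewrite -{1}[s]gK -{1}[t]gK -fm plt_rank.
have k_ex j (p : wlen (u j)) : exists k, r (existT _ j p) = c j +o k.
  apply: oadd_sub; rewrite leNgt; apply/negP => /rlt/sig_lt_same.
  by rewrite plt_rank e0 lto0.
have rE j (p : wlen (u j)) : r (existT _ j p) = c j +o rank p.
  pose k p := sval (cid (k_ex j p)).
  have kP q : r (existT _ j q) = c j +o k q := svalP (cid (k_ex j q)).
  rewrite kP; congr (_ +o _); move: p; apply: rank_uniq => [p q pq|p i ip].
    by rewrite -(lt_add2l (c j)) -!kP; apply/rlt/sig_lt_same.
  have cip : c j +o i < r (existT _ j p) by rewrite kP lt_add2l.
  have [y yE] := rank_initial cip; rewrite -[y]fK -/(r _) in yE.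
  case: (f y) yE => j' p' yE.
  have /sig_lt_proj/= jj' : sig_lt u (existT _ j' p') (existT _ j p).
    by apply/rlt; rewrite yE.
  have j'j : ple j j'.
    move: (le_addr (c j) i); rewrite -yE le_eqVlt => /predU1P[E|/rlt/sig_lt_proj//].
    left; have := can_inj gK (rank_inj E); exact: projT1_eq.
  have Ej : j = j'.
    case: jj' j'j => [//|lt1] [//|/plt_trans/(_ lt1)/plt_irrefl//].
  move: p' yE {jj' j'j}; case: j' / Ej => p' yE; exists p'.
  by apply: (@oaddI (c j)); rewrite -kP.
exists c; split.
- move=> j k jk; apply: le_ext => z.
  move=> /lt_oadd[/lt_trans|[i [/lt_len[p <-] /le_lt_trans]]]; apply.
    by apply/rlt; left.
  by rewrite -rE; apply/rlt; left.
- move=> i; split=> [/lt_len[p <-]|[j [k [/lt_len[p <-] ->]]]]; last first.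
    by rewrite -rE rank_len.
  rewrite -[p]fK; case: (f p) => j q; exists j, (rank q).
  by rewrite rank_len -rE.
- move=> j k /lt_len[p <-]; rewrite -rE strm_rank strm_rank fl gK.
  by [].
Qed.

Definition tile_of (J : cwo) (u : J -> word A) (c : J -> Ord) s e :=
  exists j, s = c j /\ e = c j +o wl (u j).

Section OffsetTiling.
Variables (J : cwo) (u : J -> word A) (x : word A) (c : J -> Ord).
Hypotheses (O : offsets u x c) (une : forall j, ozero < wl (u j)).

Lemma off_plt j k : plt j k <-> c j < c k.
Proof.
have H i l : plt i l -> c i < c l.
  by move=> /(off_lt O); apply: lt_le_trans; rewrite lt_addr.
split; first exact: H.
case: (plt_total j k) => [->|[//|/H/lt_trans/[apply]]]; by rewrite ltxx.
Qed.

Lemma off_inj j k : c j = c k -> j = k.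
Proof.
by move=> E; case: (plt_total j k) => [//|[]] /off_plt; rewrite E ltxx.
Qed.

Lemma off_end j : c j +o wl (u j) <= wl x.
Proof.
apply: le_ext => z /lt_oadd[zc|[k [ku /le_lt_trans->//]]]; last first.
  by apply/(off_cover O); exists j, k.
by apply: (lt_trans zc); apply/(off_cover O); exists j, ozero; rewrite oadd0.
Qed.

Lemma off_tiling : tiling (wl x) (tile_of u c).
Proof.
split.
- by move=> s e [j [-> ->]]; rewrite lt_addr.
- by move=> s e [j [_ ->]]; apply: off_end.
- move=> i /(off_cover O)[j [k [ku ->]]].
  by exists (c j), (c j +o wl (u j)); rewrite le_addr lt_add2l; split=> //; exists j.
- by move=> s e e' [j [-> ->]] [k [/off_inj <- ->]].
- by move=> s e s' e' [j [-> ->]] [k [-> _]] /off_plt/(off_lt O).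
Qed.

Lemma off_fac j : sub (strm x) (c j) (c j +o wl (u j)) = strm (u j).
Proof.
apply/funext => i; rewrite /sub lt_add2l; case: ltP => [iu|iu].
  exact: (off_strm O).
by rewrite (has_len_None (@strm_len (u j)) iu).
Qed.

End OffsetTiling.
End WordStreams.

(** * Prime factorizations *)

Section PrimeWords.
Context {d : Order.disp_t} {A : orderType d}.
Implicit Types w x : word A.
Local Notation wl w := (len (wlen w)).

(** The empty word is the empty product of copies of itself, and an empty index is not [is_one]. *)
Lemma primitive_gt0 w : primitive w -> ozero < wl w.
Proof.
move=> wprim; have [w0|//] := ord0_or_pos (wl w).
have O : offsets (fun _ : sub_cwo (fun _ : wlen w => False) => w) w (fun _ => ozero).
  split=> [[]//|i|[]//]; rewrite w0 lto0; by split=> // -[[]].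
by have [[[]]] := wprim _ _ (prod_of_offsets O).
Qed.

Lemma primitive_strm w : primitive w -> primitive_stream (strm w).
Proof.
move=> wprim n l wlen_l n0 Gl per.
have lE : l = wl w := has_len_uniq wlen_l (@strm_len _ _ w); rewrite lE in Gl per *.
have nl : n <= wl w := omult_ge n0 Gl (primitive_gt0 wprim).
have [y yE] := fac_word (le0o n) nl.
have yn : wl y = n.
  apply: (has_len_uniq (@strm_len _ _ y)); rewrite yE -[X in sub _ _ X]add0o.
  by apply: (has_len_fac (@strm_len _ _ w)); rewrite add0o.
(* The exponent is the set of positions of [w] at multiples of [n], where the copies of [y]
   start. *)
pose J := sub_cwo (fun p : wlen w => omult n (rank p)).
have O : offsets (fun _ : J => y) w (fun j => rank (sval j)).
  split.
  - move=> [p Gp] [q Gq] /= /plt_rank pq; rewrite yn; exact: omult_step.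
  - move=> i; split=> [il|[[p Gp] [k [ky ->]]] /=].
      have [g [r [Gg [rn iE]]]] := omult_mod i n0.
      have [p pE] : exists p : wlen w, rank p = g.
        by apply/lt_len; apply: le_lt_trans il; rewrite iE le_addr.
      have Gp : omult n (rank p) by rewrite pE.
      by exists (exist _ p Gp), r; rewrite yn /= pE.
    apply: lt_le_trans (omult_step n0 Gp Gl (rank_len p)).
    by rewrite lt_add2l -yn.
  - move=> [p Gp] k /=; rewrite yn => kn; rewrite per.
      by rewrite omodE // yE /sub add0o kn.
    apply: lt_le_trans (omult_step n0 Gp Gl (rank_len p)).
    by rewrite lt_add2l.
have [_ /word_eqE E] := wprim _ _ (prod_of_offsets O).
by rewrite -yn; apply: (has_len_uniq (@strm_len _ _ y)); rewrite E; apply: strm_len.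
Qed.

(** A power of [y] tiles [w] by a run of copies of [y], so [run_omult] and [run_pinf] supply the
    period to which stream primitivity applies. *)
Lemma strm_primitive w :
  ozero < wl w -> primitive_stream (strm w) -> primitive w.
Proof.
move=> w0 wprim y a P; set n := wl y.
have n0 : ozero < n.
  have [p _] := (lt_len _ _).1 w0; have [f _] := P.
  by have [_ q] := f p; apply: ogt0 (rank_len q).
have [c O] := offsets_of_prod P (fun _ => n0).
have TB := off_tiling O (fun _ => n0).
have [j0 [k [_ /esym ck]]] := (off_cover O _).1 w0.
have c0 : c j0 = ozero by apply/le_anti; rewrite le0o -{1}ck le_addr.
have B0 : tile_of (fun _ : a => y) c ozero n by exists j0; rewrite c0 add0o.
have runy : run (strm w) (tile_of (fun _ : a => y) c) (strm y) ozero (wl w).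
  by move=> s e [j [-> ->]] _ _; apply: (off_fac O).
have Gl : omult n (wl w).
  apply: (run_omult TB B0); first by left; rewrite add0o.
  by move=> s e [j [-> ->]].
have pinfE i : i < wl w -> strm w i = pinf n (strm y) i.
  move=> il; rewrite -[in LHS](add0o i).
  apply: (run_pinf (@strm_len _ _ w) TB (@strm_len _ _ y) n0 B0 runy) => //.
  by rewrite add0o.
have nE : n = wl w.
  apply: wprim => //; first exact: strm_len.
  move=> i il; rewrite !pinfE ?(le_lt_trans (le_omod i n0)) //.
  by rewrite /pinf [in RHS]omod_small //; have [g [_ []]] := omodP i n0.
split.
  (* A second copy could start only at [n] or later, past the end of [w]. *)
  exists j0 => j; apply: (off_inj O (fun _ => n0)); rewrite c0.
  have [//|cj] := ord0_or_pos (c j); rewrite -c0 in cj.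
  have := off_lt O ((off_plt O (fun _ => n0) _ _).2 cj); rewrite c0 add0o -/n nE.
  rewrite leNgt (lt_le_trans _ (off_end O (fun _ => n0) j)) // lt_addr; exact: n0.
apply/word_eqE/esym/strm_eq => [|p]; first by rewrite -/n nE; apply: strm_len.
by rewrite pinfE ?/pinf ?omod_small ?strm_rank -?nE ?rank_len.
Qed.

Lemma shift_strm w t : shift t (strm w) = sub (strm w) t (wl w).
Proof. by rewrite -{1}(sub_full w) shift_fac add0o. Qed.

Lemma restr_suffix w (p : wlen w) z :
  restr w (fun q => ~ plt q p) z <-> strm z = shift (rank p) (strm w).
Proof.
rewrite shift_strm; apply: restr_strm => // [|q]; first exact/ltW/rank_len.
rewrite plt_rank rank_len leNgt; split=> [/negP->//|[/negP]].
by [].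
Qed.

Lemma prime_wordE w : prime_word w <-> prime_stream (strm w).
Proof.
split=> [[wprim wmin]|[w0 [wprim wmin]]].
  have w0 := primitive_gt0 wprim; split; first by rewrite strm_len.
  split=> [|t]; first exact: primitive_strm.
  rewrite strm_len => /[dup] tl /lt_len[p pE].
  have [t0|t0] := ord0_or_pos t; first by left; rewrite shift_strm t0 sub_full.
  have [z zE] := fac_word (ltW tl) (lexx _).
  rewrite shift_strm -zE; apply/lex_leE/wmin; exists p; split.
    rewrite -pE in t0; have [q q0] := rank_initial t0.
    by exists q; apply/plt_rank; rewrite q0.
  by apply/restr_suffix; rewrite pE shift_strm.
split; first by apply: strm_primitive => //; rewrite -strm_len.
move=> z [p [_ /restr_suffix zE]]; apply/lex_leE; rewrite zE.
by apply: wmin; rewrite strm_len rank_len.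
Qed.

Lemma prime_word_gt0 w : prime_word w -> ozero < wl w.
Proof. by case=> /primitive_gt0. Qed.

Section Factorization.
Variables (J : cwo) (u : J -> word A) (x : word A) (c : J -> Ord).
Hypotheses (O : offsets u x c) (uprime : forall j, prime_word (u j)).

Let une j : ozero < wl (u j) := prime_word_gt0 (uprime j).

Lemma off_prime s e : tile_of u c s e -> prime_fac (strm x) (wl x) s e.
Proof.
move=> [j [-> ->]]; split; first exact: (off_end O une).
  by rewrite lt_addr.
by rewrite (off_fac O); apply/prime_wordE.
Qed.

Lemma off_le j k : c j <= c k -> ple j k.
Proof.
rewrite le_eqVlt => /predU1P[/(off_inj O une)|/(off_plt O une)]; [by left|by right].
Qed.

Lemma le_off j k : ple j k -> c j <= c k.
Proof. by case=> [->//|/(off_plt O une)/ltW]. Qed.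

Lemma off_dense : densely_nonincreasing u -> dense_tiling (strm x) (tile_of u c).
Proof.
move=> D s q s' e [j [-> ->]] [k [-> _]] /off_le jk.
(* The bound [g'] is the successor of [k] in [J], or [None] if [k] is last. *)
have [g' g'E] : exists g' : option J, forall i, below i g' <-> ple i k.
  have [[l kl]|N] := EM (exists l, plt k l); last first.
    exists None => i; split=> // _.
    by case: (plt_total i k) => [->|[|ki]]; [left|right|case: N; exists i].
  have [|m [[l0 [kl0 <-]] lmin]] := @omin (fun m => exists l, plt k l /\ c l = m).
    by exists (c l), l.
  exists (Some l0) => i /=; split=> [il0|[->//|/plt_trans]]; last exact.
  case: (plt_total i k) => [->|[|ki]]; [by left|by right|].
  have : c l0 <= c i by apply: lmin; exists i.
  by rewrite leNgt (off_plt O une i l0).1.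
case: (D j g') => [|H|[b [b' [[jb /g'E bk] [[jb' /g'E b'k] [bb' /lex_ltE lt]]]]]].
- exact/g'E.
- left=> t e' [i [-> ->]] ji ik; rewrite !(off_fac O); apply/word_eqE/H.
  by split; [apply: off_le | apply/g'E/off_le].
- right; exists (c b), (c b +o wl (u b)), (c b'), (c b' +o wl (u b')).
  rewrite !(off_fac O); split=> //; [by exists b|by exists b'| |exact: le_off].
  by split; [apply: le_off|apply/(off_plt O une)].
Qed.

End Factorization.

Lemma prime_factorization_uniq x (J : cwo) (u : J -> word A) (J' : cwo)
    (u' : J' -> word A) :
  prime_factorization x u -> prime_factorization x u' ->
  exists h : J -> J', ord_iso h /\ forall j, word_eq (u j) (u' (h j)).
Proof.
move=> [P [D X]] [P' [D' X']].
have ne j := prime_word_gt0 (P j); have ne' j := prime_word_gt0 (P' j).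
have [c O] := offsets_of_prod X ne; have [c' O'] := offsets_of_prod X' ne'.
have BE := dense_tiling_uniq (@strm_len _ _ x) (off_tiling O ne) (off_tiling O' ne')
  (off_prime O P) (off_prime O' P') (off_dense O P D) (off_dense O' P' D').
have h_ex j : exists j', c j = c' j' /\ c j +o wl (u j) = c' j' +o wl (u' j').
  have /BE[j' H] : tile_of u c (c j) (c j +o wl (u j)) by exists j.
  by exists j'.
have g_ex j' : exists j, c j = c' j'.
  have /BE[j [H _]] : tile_of u' c' (c' j') (c' j' +o wl (u' j')) by exists j'.
  by exists j.
pose h j := sval (cid (h_ex j)); pose g j := sval (cid (g_ex j)).
have hP j : c j = c' (h j) /\ c j +o wl (u j) = c' (h j) +o wl (u' (h j)) :=
  svalP (cid (h_ex j)).
have gP j : c (g j) = c' j := svalP (cid (g_ex j)).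
exists h; split; first split.
- exists g => j.
    by apply: (off_inj O ne); rewrite gP -(hP j).1.
  by apply: (off_inj O' ne'); rewrite -(hP _).1 gP.
- by move=> j k; rewrite (off_plt O ne) (hP j).1 (hP k).1 (off_plt O' ne').
- move=> j; apply/word_eqE; rewrite -(off_fac O) -(off_fac O').
  by have [<- <-] := hP j.
Qed.

Lemma prime_factorization_exists x :
  exists (J : cwo) (u : J -> word A), prime_factorization x u.
Proof.
pose M := max_prime_fac (strm x) (wl x).
have TM : tiling (wl x) M := max_prime_tiling (@strm_len _ _ x).
(* The index set consists of the positions of [x] where a maximal prime factor starts, which keeps
   it countable. *)
pose J := sub_cwo (fun p : wlen x => exists e, M (rank p) e).
pose c (j : J) := rank (sval j).
have u_ex (j : J) : exists w, M (c j) (c j +o wl w) /\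
    strm w = sub (strm x) (c j) (c j +o wl w).
  have [e Me] := svalP j; have [l lE] := oadd_sub (ltW (tile_lt TM Me)).
  have [w wE] := fac_word (ltW (tile_lt TM Me)) (tile_le TM Me).
  have wll : wl w = l.
    apply: (has_len_uniq (@strm_len _ _ w)); rewrite wE lE.
    by apply: (has_len_fac (@strm_len _ _ x)); rewrite -lE; apply: (tile_le TM Me).
  by exists w; rewrite wll -lE.
pose u j := sval (cid (u_ex j)).
have uP j : M (c j) (c j +o wl (u j)) /\
    strm (u j) = sub (strm x) (c j) (c j +o wl (u j)) := svalP (cid (u_ex j)).
have start s e : M s e -> exists j : J, c j = s /\ c j +o wl (u j) = e.
  move=> Ms; have [p pE] : exists p : wlen x, rank p = s.
    by apply/lt_len; apply: lt_le_trans (tile_lt TM Ms) (tile_le TM Ms).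
  have Sp : exists e, M (rank p) e by exists e; rewrite pE.
  exists (exist _ p Sp : J); split=> //; apply: (tile_fun TM (uP _).1).
  by rewrite /c /= pE.
have O : offsets u x c.
  split.
  - move=> j k jk; apply: (tile_disj TM (uP j).1 (uP k).1).
    exact: (plt_rank (sval j) (sval k)).1 jk.
  - move=> i; split=> [/(tile_cover TM)[s [e [Ms]]]|[j [k [ku ->]]]].
      have [j [<- <-]] := start _ _ Ms; move=> /oadd_sub[k ->].
      by rewrite lt_add2l => ku; exists j, k.
    by apply: lt_le_trans (tile_le TM (uP j).1); rewrite lt_add2l.
  - by move=> j k ku; rewrite (uP j).2 /sub lt_add2l ku.
have uprime j : prime_word (u j).
  by apply/prime_wordE; rewrite (uP j).2; have [[]] := (uP j).1.
exists J, u; split=> //; split; last exact: prod_of_offsets O.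
have ne j := prime_word_gt0 (uprime j).
move=> g g' gg'; apply: contrapT => /not_orP[Nconst Ndesc]; apply: Nconst.
have [//|N] := EM (forall b, in_iv g g' b -> word_eq (u b) (u g)).
(* At the first factor [b] that differs from [u g], absence of a descent forces an ascent after a
   run of copies of [u g], which [max_prime_no_ascent] forbids. *)
have [|m [[b [[gb bg'] [Nb bE]]] bmin]] := @omin (fun m =>
    exists b, in_iv g g' b /\ ~ word_eq (u b) (u g) /\ c b = m).
  by move/existsNP: N => [b /not_implyP[bI Nb]]; exists (c b), b.
have {}gb : plt g b.
  by case: gb => // E; case: Nb; rewrite E; apply/word_eqE.
have gI : in_iv g g' g by split; [left|].
case: (slt_total (strm (u b)) (strm (u g))) => [/word_eqE//|[lt|lt]].
  case: Ndesc; exists g, b; split=> //; split; first by split=> //; right.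
  by split=> //; apply/lex_ltE.
have rn : run (strm x) M (sub (strm x) (c g) (c g +o wl (u g))) (c g) (c b).
  move=> s e /start[i [<- <-]] /(off_le O uprime) gi /(off_plt O ne) ib.
  rewrite !(off_fac O); apply/word_eqE; apply: contrapT => Ni.
  have : m <= c i.
    apply: bmin; exists i; split=> //; split=> //.
    by move: bg'; case: (g') => //= k; apply: plt_trans.
  by rewrite leNgt -bE (off_plt O ne i b).1.
have := max_prime_no_ascent (@strm_len _ _ x) (uP g).1 (uP b).1 _ rn.
rewrite !(off_fac O) => /(_ _ lt)[].
exact/(off_plt O ne).
Qed.

End PrimeWords.

Theorem mainTheorem1 (d : Order.disp_t) (A : finOrderType d) (x : word A) :
  (exists (J : cwo) (u : J -> word A), prime_factorization x u) /\
  (forall (J : cwo) (u : J -> word A) (J' : cwo) (u' : J' -> word A),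
     prime_factorization x u -> prime_factorization x u' ->
     exists h : J -> J', ord_iso h /\ forall j, word_eq (u j) (u' (h j))).
Proof.
split; first exact: prime_factorization_exists.
by move=> J u J' u'; apply: prime_factorization_uniq.
Qed.
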